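(* Let $m>0$. The inner Schwarzschild spacetime, i.e. the manifold $(0,2m)\times\mathbb{R}\times S^2$ with coordinates $r\in(0,2m)$, $s\in\mathbb{R}$ and the metric $$-\Big(1-\frac{2m}{r}\Big)ds^2+\Big(1-\frac{2m}{r}\Big)^{-1}dr^2+r^2(d\theta^2+\sin^2\theta\,d\phi^2),$$ is geodesically connected, even though the Lorentzian surface $(0,2m)\times\mathbb{R}$ with the metric $$-\Big(1-\frac{2m}{r}\Big)ds^2+\Big(1-\frac{2m}{r}\Big)^{-1}dr^2$$ is not geodesically connected.
   Context: $d\theta^2+\sin^2\theta\,d\phi^2$ is the round metric of the unit sphere $S^2$. A semi-Riemannian manifold is geodesically connected if each pair of its points can be joined by a geodesic. With the variable $\tau$ given by $d\tau=(-1+\frac{2m}{r})^{-1/2}dr$, the first metric takes the multiwarped form $-d\tau^2+f_1^2ds^2+f_2^2 g_{S^2}$ on $I\times\mathbb{R}\times S^2$ with $f_1^2=\frac{2m}{r}-1$, $f_2=r$, and the second one is $-d\tau^2+f_1^2ds^2$ on $I\times\mathbb{R}$. *)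

(* Defs.v *)
From HB Require Import structures.
From mathcomp Require Import all_boot all_order all_algebra.
From mathcomp Require Import all_classical all_reals all_analysis.
From mathcomp Require Import ring.

Set Implicit Arguments.
Unset Strict Implicit.
Unset Printing Implicit Defensive.

Import Order.TTheory GRing.Theory Num.Theory.
Import numFieldNormedType.Exports.

Local Open Scope ring_scope.
Local Open Scope classical_set_scope.

Definition partial (R : realType) (n : nat) (i : 'I_n)
    (f : 'rV[R]_n -> R) (x : 'rV[R]_n) : R :=
  'D_(delta_mx 0 i) f x.

Definition christoffel (R : realType) (n : nat) (g : 'rV[R]_n -> 'M[R]_n)
    (x : 'rV[R]_n) (k i j : 'I_n) : R :=
  2^-1 * \sum_(l < n) invmx (g x) k l *
    (partial i (fun y => g y j l) x + partial j (fun y => g y i l) x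
     - partial l (fun y => g y i j) x).

(* A solution of this equation on an open interval is automatically smooth
   when g is, so no further regularity is imposed on geodesics. *)
Definition geodesic_equation (R : realType) (n : nat)
    (g : 'rV[R]_n -> 'M[R]_n) (u : R -> 'rV[R]_n) (t : R) : Prop :=
  let x (i : 'I_n) (s : R) : R := u s 0 i in
  forall k : 'I_n,
    [/\ derivable (x k) t 1, derivable (derive1 (x k)) t 1 &
        derive1 (derive1 (x k)) t
        + \sum_(i < n) \sum_(j < n)
            christoffel g (u t) k i j * derive1 (x i) t * derive1 (x j) t = 0].

(* A chart is given by its inverse, a parametrization of a part of E by an
   open subset of R^n, together with the matrix of the metric in the
   corresponding coordinates. *)
Record chart (R : realType) (n : nat) (E : Type) := Chart {
  chart_dom : set 'rV[R]_n ;
  chart_map : 'rV[R]_n -> E ;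
  chart_metric : 'rV[R]_n -> 'M[R]_n }.

(* The geodesic equation is invariant under isometric changes of coordinates,
   so that around each t it is enough to test it in one chart of the atlas. *)
Definition geodesic (R : realType) (n : nat) (E : Type)
    (A : set (chart R n E)) (J : set R) (gamma : R -> E) : Prop :=
  forall t, J t -> exists2 c, A c & exists u : R -> 'rV[R]_n,
    \forall s \near t, [/\ chart_dom c (u s), gamma s = chart_map c (u s) &
                           geodesic_equation (chart_metric c) u s].

(* A geodesic on [0, 1] always extends to an open interval ]a, b[ around it. *)
Definition joined_by_geodesic (R : realType) (n : nat) (E : Type)
    (A : set (chart R n E)) (p q : E) : Prop :=
  exists (a b : R) (gamma : R -> E),
    [/\ a < 0, 1 < b, geodesic A `]a, b[%classic gamma,
        gamma 0 = p & gamma 1 = q].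

Definition geodesically_connected (R : realType) (n : nat) (E : Type)
    (M : set E) (A : set (chart R n E)) : Prop :=
  forall p q, M p -> M q -> joined_by_geodesic A p q.

Section Schwarzschild.
Variables (R : realType) (m : R).

Definition inner_surface : set 'rV[R]_2 := [set x | 0 < x 0 0 < 2 * m].

(* Coordinates (r, s). *)
Definition inner_surface_metric (u : 'rV[R]_2) : 'M[R]_2 :=
  let r := u 0 0 in
  diag_mx (\row_k [:: (1 - 2 * m / r)^-1; - (1 - 2 * m / r)]`_k).

Definition inner_surface_atlas : set (chart R 2 'rV[R]_2) :=
  [set Chart inner_surface id inner_surface_metric].

Definition sphere2 : set 'rV[R]_3 := [set x | \sum_k x 0 k ^+ 2 = 1].

Definition spherical (theta phi : R) : 'rV[R]_3 :=
  \row_k [:: sin theta * cos phi; sin theta * sin phi; cos theta]`_k.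

Definition inner_schwarzschild : set (R * R * 'rV[R]_3) :=
  [set p | 0 < p.1.1 < 2 * m /\ sphere2 p.2].

(* Coordinates (r, s, theta, phi). *)
Definition inner_schwarzschild_metric (u : 'rV[R]_4) : 'M[R]_4 :=
  let r := u 0 0 in let theta := u 0 2 in
  diag_mx (\row_k [:: (1 - 2 * m / r)^-1; - (1 - 2 * m / r);
                      r ^+ 2; r ^+ 2 * sin theta ^+ 2]`_k).

(* Spherical coordinates with respect to an arbitrary orthonormal basis of
   R^3, the rows of Q: a single system of spherical coordinates omits a half
   great circle, whereas these cover the sphere (spherical_cover), and the
   metric dtheta^2 + sin^2 theta dphi^2 does not depend on Q, being the one
   induced by R^3 (spherical_round). *)
Definition inner_schwarzschild_chart (Q : 'M[R]_3) :
    chart R 4 (R * R * 'rV[R]_3) :=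
  Chart [set u | [/\ 0 < u 0 0 < 2 * m, 0 < u 0 2 < pi & - pi < u 0 3 < pi]]
        (fun u => (u 0 0, u 0 1, spherical (u 0 2) (u 0 3) *m Q))
        inner_schwarzschild_metric.

Definition inner_schwarzschild_atlas : set (chart R 4 (R * R * 'rV[R]_3)) :=
  [set inner_schwarzschild_chart Q | Q in [set Q | Q *m Q^T = 1%:M]].

End Schwarzschild.

Section Sphere.
Variable R : realType.
Implicit Types (Q : 'M[R]_3) (x y : 'rV[R]_3) (theta phi : R).

Lemma dotE x y : \sum_k x 0 k * y 0 k = (x *m y^T) 0 0.
Proof. by rewrite mxE; apply: eq_bigr => k _; rewrite mxE. Qed.

Lemma sphere2E x : sphere2 x <-> x *m x^T = 1%:M.
Proof.
rewrite /sphere2 /=; under eq_bigr do rewrite expr2.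
rewrite dotE; split=> [h|->]; last by rewrite mxE.
by apply/matrixP => i j; rewrite !ord1 h mxE.
Qed.

Lemma spherical_sphere2 Q theta phi :
  Q *m Q^T = 1%:M -> sphere2 (spherical theta phi *m Q).
Proof.
move=> hQ; apply/sphere2E; rewrite trmx_mul mulmxA -(mulmxA _ Q) hQ mulmx1.
apply/sphere2E; rewrite /sphere2 /= !big_ord_recl big_ord0 !mxE /=.
rewrite addr0 addrA !exprMn -mulrDr cos2Dsin2 mulr1 addrC.
exact: cos2Dsin2.
Qed.

Lemma spherical_cover x : sphere2 x ->
  exists Q theta phi, [/\ Q *m Q^T = 1%:M, 0 < theta < pi, - pi < phi < pi &
                          x = spherical theta phi *m Q].
Proof.
move=> /sphere2E hx.
pose e : 'rV[R]_3 := spherical (pi / 2) 0.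
have he : e *m e^T = 1%:M.
  apply/sphere2E; rewrite -[e]mulmx1.
  by apply: spherical_sphere2; rewrite trmx1 mulmx1.
have hpi := pi_gt0 R.
suff [Q hQ ->] : exists2 Q, Q *m Q^T = 1%:M & x = e *m Q.
  exists Q, (pi / 2), 0; split=> //.
    by rewrite divr_gt0 //= ltr_pdivrMr // ltr_pMr // ltr1n.
  by rewrite oppr_lt0 hpi.
have [xe|xe] := eqVneq x e.
  by exists 1%:M; rewrite ?trmx1 mulmx1.
pose v := e - x.
have [d hd] : exists d, v *m v^T = d%:M.
  by exists ((v *m v^T) 0 0); apply/matrixP => i j; rewrite !ord1 !mxE eqxx mulr1n.
have [c hc] : exists c, e *m x^T = c%:M.
  by exists ((e *m x^T) 0 0); apply/matrixP => i j; rewrite !ord1 !mxE eqxx mulr1n.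
have hc' : x *m e^T = c%:M by rewrite -[LHS]trmxK trmx_mul trmxK hc tr_scalar_mx.
have hev : e *m v^T = (1 - c)%:M by rewrite linearB mulmxBr he hc raddfB.
have dE : d = 2 * (1 - c).
  have : v *m v^T = (2 * (1 - c))%:M.
    rewrite {1}/v mulmxBl hev {1}/v [(e - x)^T]linearB /= mulmxBr hc' hx -!raddfB.
    by congr (_%:M); ring.
  by rewrite hd => /matrixP/(_ 0 0); rewrite !mxE !mulr1n.
have d0 : d != 0.
  apply: contraNneq xe => d0; move: hd; rewrite d0 => /matrixP/(_ 0 0).
  rewrite -dotE mxE mul0rn => /eqP; rewrite psumr_eq0 => [|k _]; last first.
    by rewrite -expr2 sqr_ge0.
  move=> /allP h; apply/eqP/esym/rowP => k.
  have := h k (mem_index_enum k); rewrite /= -expr2 sqrf_eq0 !mxE subr_eq0.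
  by move=> /eqP.
pose Q : 'M[R]_3 := 1%:M - (2 / d) *: (v^T *m v).
have QT : Q^T = Q.
  by rewrite /Q linearB /= trmx1 linearZ /= trmx_mul trmxK.
have vQ : v *m Q = - v.
  rewrite /Q mulmxBr mulmx1 -scalemxAr mulmxA hd mul_scalar_mx scalerA.
  by rewrite divfK // scaler_nat mulr2n opprD addrA subrr add0r.
exists Q; last first.
  rewrite /Q mulmxBr mulmx1 -scalemxAr mulmxA hev mul_scalar_mx scalerA.
  suff -> : 2 / d * (1 - c) = 1 by rewrite scale1r subKr.
  by rewrite mulrAC -dE divff.
rewrite QT {1}/Q mulmxBl mul1mx -scalemxAl -mulmxA vQ mulmxN scalerN opprK.
by rewrite /Q subrK.
Qed.

Lemma spherical_round Q theta phi : Q *m Q^T = 1%:M ->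
  let x theta phi : 'rV[R]_3 := spherical theta phi *m Q in
  let dtheta : 'rV[R]_3 := \row_k derive1 (fun t => x t phi 0 k) theta in
  let dphi : 'rV[R]_3 := \row_k derive1 (fun t => x theta t 0 k) phi in
  [/\ \sum_k dtheta 0 k * dtheta 0 k = 1,
      \sum_k dtheta 0 k * dphi 0 k = 0 &
      \sum_k dphi 0 k * dphi 0 k = sin theta ^+ 2].
Proof.
move=> hQ x dtheta dphi.
have dot (a b a' b' : 'rV[R]_3) : a' = a *m Q -> b' = b *m Q ->
    \sum_k a' 0 k * b' 0 k = \sum_k a 0 k * b 0 k.
  by move=> -> ->; rewrite !dotE trmx_mul mulmxA -(mulmxA a) hQ mulmx1.
pose a : 'rV[R]_3 :=
  \row_k [:: cos theta * cos phi; cos theta * sin phi; - sin theta]`_k.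
pose b : 'rV[R]_3 :=
  \row_k [:: - (sin theta * sin phi); sin theta * cos phi; 0]`_k.
have xE t s k : x t s 0 k =
    sin t * cos s * Q 0 k + sin t * sin s * Q 1 k + cos t * Q 2 k.
  rewrite mxE !big_ord_recl big_ord0 !mxE /= addr0 addrA.
  by congr (_ + _ * Q _ _ + _ * Q _ _); apply: val_inj.
have yE (y : 'rV[R]_3) k :
    (y *m Q) 0 k = y 0 0 * Q 0 k + y 0 1 * Q 1 k + y 0 2 * Q 2 k.
  rewrite mxE !big_ord_recl big_ord0 /= addr0 addrA.
  by congr (_ + y _ _ * Q _ _ + y _ _ * Q _ _); apply: val_inj.
have ha : dtheta = a *m Q.
  apply/rowP => k; rewrite mxE derive1E yE !mxE /=.
  under eq_fun do rewrite xE.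
  apply: derive_val.
  apply: is_derive_eq.
  rewrite /GRing.scale /=; ring.
have hb : dphi = b *m Q.
  apply/rowP => k; rewrite mxE derive1E yE !mxE /=.
  under eq_fun do rewrite xE.
  apply: derive_val.
  apply: is_derive_eq.
  rewrite /GRing.scale /=; ring.
rewrite !(dot _ _ _ _ ha ha, dot _ _ _ _ ha hb, dot _ _ _ _ hb hb).
rewrite !big_ord_recl !big_ord0 !mxE /=.
have h1 := cos2Dsin2 theta; have h2 := cos2Dsin2 phi.
split.
- rewrite -[RHS]h1 -[cos theta ^+ 2 in RHS]mulr1 -h2; ring.
- ring.
- rewrite -[RHS]mulr1 -h2; ring.
Qed.

End Sphere.

(* Main.v *)
(* A geodesic of the inner Schwarzschild spacetime runs along a great circle of
   S^2, and its angle [phi] is only prescribed modulo [2 pi]. Writing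
   [2 m / r = 1 + W (1 + z^2)], the orbits on which [r] reaches a maximum, at
   [z = 0], depend on two parameters [W > 0] and [0 < mu <= 1]; along them
   [phi] and [s] are integrals over [z] whose integrands are smooth across the
   turning point. For fixed end points let [Phi (W, mu)] and [T (W, mu)] be the
   increments of [phi] and [s]. Then [Phi] strictly decreases in [W], decreases
   in [mu], and is unbounded both as [W -> 0] and as [mu -> 0], whereas [T]
   vanishes at [mu = 1] and [T >= c Phi] for some [W] and all [mu <= 1/2].
   Hence, once a large multiple of [2 pi] has been added to the required angle,
   [T] takes every value from [0] to the required one along a level curve of
   [Phi].

   On the surface nothing can wind: a geodesic leaving [r = m] and coming back
   is spacelike, so [r] is a convex function of the affine parameter, and the
   conservation laws bound the increment of [s] by a multiple of [m]. *)

Require Import Defs.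
From mathcomp Require Import all_boot all_order all_algebra.
From mathcomp Require Import all_classical all_reals all_analysis.
From mathcomp Require Import ring lra.

Set Implicit Arguments.
Unset Strict Implicit.
Unset Printing Implicit Defensive.

Import Order.TTheory GRing.Theory Num.Theory.
Import numFieldNormedType.Exports.

Local Open Scope ring_scope.
Local Open Scope classical_set_scope.

(** * Calculus *)

Section MeanValue.
Context {R : realType}.
Implicit Types (f g F : R -> R).

Lemma is_derive1_continuous f (x l : R) : is_derive x 1 f l -> {for x, continuous f}.
Proof. by move=> fl; apply/differentiable_continuous/derivable1_diffP. Qed.

Lemma mean_value f (df : R -> R) (a b : R) : a <= b ->
  (forall x, a <= x <= b -> is_derive x 1 f (df x)) ->
  exists2 c, a <= c <= b & f b - f a = df c * (b - a).
Proof.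
move=> ab fdf; have [||c] := @MVT_segment R f df a b ab.
- by move=> x; rewrite in_itv /= => /andP[ax xb]; apply: fdf; rewrite !ltW.
- apply: derivable_within_continuous => x; rewrite in_itv /= => xab.
  by have [] := fdf x xab.
by rewrite in_itv /= => cab ->; exists c.
Qed.

Lemma derive0_constant f (a b : R) : a <= b ->
  (forall x, a <= x <= b -> is_derive x 1 f 0) -> f b = f a.
Proof.
move=> ab /(mean_value ab)[c _] /eqP.
by rewrite mul0r subr_eq0 => /eqP.
Qed.

Lemma derive_ge0_le f (df : R -> R) (a b : R) : a <= b ->
  (forall x, a <= x <= b -> is_derive x 1 f (df x)) ->
  (forall x, a <= x <= b -> 0 <= df x) -> f a <= f b.
Proof.
move=> ab /(mean_value ab)[c cab e] /(_ c cab) dc.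
by rewrite -subr_ge0 e mulr_ge0 // subr_ge0.
Qed.

Lemma derive_gt0_lt f (df : R -> R) (a b : R) : a < b ->
  (forall x, a <= x <= b -> is_derive x 1 f (df x)) ->
  (forall x, a <= x <= b -> 0 < df x) -> f a < f b.
Proof.
move=> ab /(mean_value (ltW ab))[c cab e] /(_ c cab) dc.
by rewrite -subr_gt0 e mulr_gt0 // subr_gt0.
Qed.

(** In the orbit estimates this plays the role of monotonicity of the integral: increments of
    antiderivatives stand for integrals. *)
Lemma derive_le_increment f g (df dg : R -> R) (a b : R) : a <= b ->
  (forall x, a <= x <= b -> is_derive x 1 f (df x)) ->
  (forall x, a <= x <= b -> is_derive x 1 g (dg x)) ->
  (forall x, a <= x <= b -> df x <= dg x) -> f b - f a <= g b - g a.
Proof.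
move=> ab fdf gdg le; suff : g a - f a <= g b - f b by lra.
apply: (@derive_ge0_le (fun x => g x - f x) (fun x => dg x - df x)) => // x xab.
  by have := fdf x xab; have := gdg x xab => ? ?; apply: is_deriveB.
by rewrite subr_ge0 le.
Qed.

(** The fundamental theorem of calculus on a bounded interval. The normalisation [F 0 = 0] makes the
    antiderivatives on different intervals agree, so that they can be glued. *)
Let local_antiderivative f (n : R) : 0 < n -> continuous f ->
  exists F : R -> R, F 0 = 0 /\ forall x : R, - n < x < n -> is_derive x 1 F (f x).
Proof.
move=> n0 cf.
pose G x := (\int[lebesgue_measure]_(t in `[- n, x]) f t)%R.
exists (fun x => G x - G 0); split; first by rewrite subrr.
move=> x /andP[nx xn].
have [] := @continuous_FTC1_closed R f (- n) x n xn _ nx (cf x).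
  apply: continuous_compact_integrable; first exact: segment_compact.
  exact: continuous_subspaceT.
move=> dG G'; have hG : is_derive x 1 G (f x).
  by apply: DeriveDef; rewrite -?G' ?derive1E.
by rewrite -[f x]subr0; apply: is_deriveB.
Qed.

Lemma antiderivative f : continuous f ->
  exists F, forall x : R, is_derive x 1 F (f x).
Proof.
move=> cf.
have /choice[G GP] : forall n : nat, exists F, F 0 = 0 /\
    forall x : R, - n.+1%:R < x < n.+1%:R -> is_derive x 1 F (f x).
  by move=> n; apply: local_antiderivative => //; rewrite ltr0Sn.
have GE n k x : `|x| < n.+1%:R -> `|x| < k.+1%:R -> G n x = G k x.
  move=> xn xk; pose H y := G n y - G k y.
  have dH (y : R) : `|y| <= `|x| -> is_derive y 1 H 0.
    move=> yx; rewrite -[0](subrr (f y)).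
    have [_ /(_ y) Gn] := GP n; have [_ /(_ y) Gk] := GP k.
    apply: is_deriveB; [apply: Gn | apply: Gk]; rewrite -ltr_norml.
      exact: (le_lt_trans yx xn).
    exact: (le_lt_trans yx xk).
  suff : H x = H 0.
    by rewrite /H (GP n).1 (GP k).1 subrr => /eqP; rewrite subr_eq0 => /eqP.
  have [x0|x0] := leP 0 x.
    apply: derive0_constant => // y /andP[y0 yx]; apply: dH.
    by rewrite !ger0_norm.
  apply/esym/derive0_constant; first exact: ltW.
  move=> y /andP[xy y0]; apply: dH.
  by rewrite !ler0_norm ?lerN2 // ltW.
exists (fun x => G (Num.truncn `|x|) x) => x.
(* One unit more than [x] needs: the single function [G k] then serves on the whole ball of radius 1
   around [x]. *)
pose k := Num.truncn (`|x| + 1).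
have [_ /(_ x) Gk] := GP k.
have xk : `|x| + 1 < k.+1%:R by exact: truncnS_gt.
have yk : \forall y \near x, `|y| < k.+1%:R.
  exists 1 => //= y; rewrite /ball_ /= distrC => xy.
  by rewrite -(subrK x y) (le_lt_trans (ler_normD _ _)) //; lra.
apply: (near_eq_is_derive _ (Gk _)); last by rewrite -ltr_norml (nbhs_singleton yk).
near=> y; apply: GE; last exact: truncnS_gt.
by near: y.
Unshelve. all: end_near. Qed.
End MeanValue.

(** * Parametric increments, autonomous equations and level curves *)

Section ParametricCalculus.
Context {R : realType}.

(** By the mean value theorem for [H p0 - H p], the two increments differ by [G p0 c - G p c] for
    some [c] in [0, 1]. Compactness of [0, 1] makes this small uniformly in [c] as [p] tends to
    [p0]. *)
Lemma parametric_increment_continuous (T : topologicalType) (p0 : T)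
    (H G : T -> R -> R) :
  (\forall p \near p0, forall y : R, 0 <= y <= 1 -> is_derive y 1 (H p) (G p y)) ->
  (forall y : R, 0 <= y <= 1 ->
     {for (p0, y), continuous (fun q : T * R => G q.1 q.2)}) ->
  {for p0, continuous (fun p => H p 1 - H p 0)}.
Proof.
move=> HG cG; apply/cvgrPdist_le => e e0.
have : \forall p \near p0, `[0, 1]%classic `<=`
    [set y | `|G p0 y - G p y| < e].
  have /compact_near_coveringP := @segment_compact R 0 1.
  apply=> y /=; rewrite in_itv /= => /cG/cvgrPdist_lt/(_ _ (divr_gt0 e0 (ltr0Sn R 1))).
  case=> -[/= A B] [Ap By] AB.
  exists (B, A) => //= -[z p] [/= Bz Ap'].
  have := AB (p, z) (conj Ap' Bz); have := AB (p0, z) (conj (nbhs_singleton Ap) Bz).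
  rewrite /= distrC => h1 h2.
  rewrite -(subrKA (G p0 y)) (le_lt_trans (ler_normD _ _)) //; lra.
apply: filter_app; have H0 := nbhs_singleton HG; move: HG; apply: filterS => p Hp near.
have [c c01] : exists2 c, 0 <= c <= 1 & (H p0 1 - H p 1) - (H p0 0 - H p 0) =
    (G p0 c - G p c) * (1 - 0).
  apply: (@mean_value R (fun y => H p0 y - H p y)) => // y y01.
  by have := H0 y y01; have := Hp y y01 => ? ?; apply: is_deriveB.
rewrite subr0 mulr1 => E; have -> : H p0 1 - H p0 0 - (H p 1 - H p 0) = G p0 c - G p c.
  rewrite -E; ring.
by apply/ltW/near; rewrite /= in_itv.
Qed.

(** Separation of variables: the time needed to reach [x] is an antiderivative of [1 / f], and [z]
    is its inverse after an affine rescaling by [v] that sends [z0] and [z1] to times 0 and 1.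
    Running from [z0 - 1] to [z1 + 1] leaves room for an open interval around [0, 1]. *)
Lemma autonomous_ode (f : R -> R) (z0 z1 : R) : continuous f ->
  (forall x, 0 < f x) -> z0 < z1 ->
  exists (v a b : R) (z : R -> R), [/\ 0 < v, a < 0, 1 < b, z 0 = z0 /\ z 1 = z1 &
    forall t : R, a < t < b -> is_derive t 1 z (v * f (z t))].
Proof.
move=> cf f0 z01.
have [T TP] : exists T : R -> R, forall x : R, is_derive x 1 T (f x)^-1.
  apply: antiderivative => x; apply: cvgV; last exact: cf.
  by rewrite gt_eqF.
have Tmono (x y : R) : x < y -> T x < T y.
  move=> xy; apply: (@derive_gt0_lt R T (fun x => (f x)^-1)) => // w _.
  by rewrite invr_gt0.
pose v := T z1 - T z0.
have v0 : 0 < v by rewrite subr_gt0 Tmono.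
pose tau x := (T x - T z0) / v.
have taumono (x y : R) : x < y -> tau x < tau y.
  by move=> xy; rewrite /tau ltr_pM2r ?invr_gt0 // ltrD2r Tmono.
have tauI : injective tau.
  by move=> x y e; have [/taumono|/taumono|//] := ltgtP x y; rewrite e ltxx.
have dtau (x : R) : is_derive x 1 tau (v * f x)^-1.
  have := TP x => Tx; apply: is_derive_eq.
  by rewrite /GRing.scale /= invfM; ring.
(* Outside the range of [tau] this is the default [z0]; every time in []a, b[] lies in the range, by
   the intermediate value theorem. *)
pose z t := xget z0 [set x | tau x = t].
have ztau : cancel tau z.
  move=> x; apply: tauI; rewrite /z.
  by apply: (@xgetPex _ z0 [set y | tau y = tau x]); exists x.
have tau0 : tau z0 = 0 by rewrite /tau subrr mul0r.
have tau1 : tau z1 = 1 by rewrite /tau -/v divff // gt_eqF.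
exists v, (tau (z0 - 1)), (tau (z1 + 1)), z; split => //.
- by rewrite -[ltRHS]tau0; apply: taumono; rewrite ltrBlDr ltrDl.
- by rewrite -[ltLHS]tau1; apply: taumono; rewrite ltrDl.
- by split; rewrite -?[X in z X]tau0 -?[X in z X]tau1 ztau.
move=> t /andP[at_ tb].
have [x _ tx] : exists2 x, x \in `[z0 - 1, z1 + 1]%R & tau x = t.
  apply: IVT.
  - by lra.
  - by apply: derivable_within_continuous => x _; case: (dtau x).
  - by rewrite ge_min le_max (ltW at_) (ltW tb) orbT.
rewrite -tx ztau -[_ * _]invrK.
apply: is_derive_inverse; last by rewrite invr_eq0 mulf_neq0 ?gt_eqF.
- by near=> y; exact: ztau.
- by near=> y; exact: is_derive1_continuous (dtau y).
Unshelve. all: end_near. Qed.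

(* By strict monotonicity the level set [Phi = P] is the graph of a continuous
   function of [u], along which [S] takes the value [s]. *)
Lemma level_curve_ivt (Phi S : R -> R -> R) (a b c d P s : R) :
  a <= b -> c <= d ->
  (forall w u, a <= w <= b -> c <= u <= d ->
     {for (w, u), continuous (fun q : R * R => Phi q.1 q.2)}) ->
  (forall w u, a <= w <= b -> c <= u <= d ->
     {for (w, u), continuous (fun q : R * R => S q.1 q.2)}) ->
  (forall w w' u, a <= w -> w < w' -> w' <= b -> c <= u <= d ->
     Phi w' u < Phi w u) ->
  (forall u, c <= u <= d -> Phi b u <= P <= Phi a u) ->
  Phi b c = P -> s <= S b c -> (forall w, a <= w <= b -> S w d <= s) ->
  exists w u, [/\ a <= w <= b, c <= u <= d, Phi w u = P & S w u = s].
Proof.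
move=> ab cd cPhi cS decr bnd Pbc sbc Sd.
(* Clamping to [c, d] makes the level curve a function on the whole line, where continuity needs no
   restriction to a subspace. *)
pose k (u : R) := Num.max c (Num.min u d).
have kcd u : c <= k u <= d by rewrite /k le_max lexx ge_max cd ge_min lexx orbT.
have kid u : c <= u <= d -> k u = u.
  by move=> /andP[cu ud]; rewrite /k min_l // max_r.
have ck : continuous k.
  move=> u; apply: (@continuous_max _ _ (fun=> c) (fun u => Num.min u d)).
    exact: cvg_cst.
  by apply: (@continuous_min _ _ id (fun=> d)); [exact: cvg_id|exact: cvg_cst].
have section_cont (F : R -> R -> R) (f : R -> R) (u : R) :
    {for (f u, k u), continuous (fun q : R * R => F q.1 q.2)} ->
    {for u, continuous f} -> {for u, continuous (fun t => F (f t) (k t))}.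
  move=> cF cf.
  exact: (cvg_comp _ _ (cvg_pair cf (ck u)) cF).
have /choice[om omP] : forall u : R, exists w : R, a <= w <= b /\ Phi w (k u) = P.
  move=> u; have [||w] := @IVT R (Phi^~ (k u)) a b P ab.
  - apply: continuous_in_subspaceT => w; rewrite inE /= in_itv /= => wab.
    exact: (cvg_comp _ _ (cvg_pair (@cvg_id _ (nbhs w)) (cvg_cst (k u)))
      (cPhi w (k u) wab (kcd u))).
  - by have /andP[h1 h2] := bnd _ (kcd u); rewrite ge_min le_max h1 h2 orbT.
  - by rewrite in_itv /= => wab e; exists w.
have omc : continuous om.
  (* If [om u] reached [om u0 + e], monotonicity in [w] would give [P <= Phi (om u0 + e) (k u)],
     whereas this value is below [P] at [u0] and hence near it. The lower bound is symmetric, and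
     both are trivial when [om u0 + e] or [om u0 - e] leaves [a, b]. *)
  move=> u0; apply/cvgrPdist_lt => e e0.
  have [/andP[a0 b0] P0] := omP u0.
  have up : \forall u \near u0, om u < om u0 + e.
    have [lt|ge] := ltP b (om u0 + e).
      by near=> u; have [/andP[_ /le_lt_trans->]] := omP u.
    have lt0 : om u0 < om u0 + e by rewrite ltrDl.
    have ae : a <= om u0 + e by rewrite (le_trans a0) // ltW.
    have c1 : {for u0, continuous (fun t => Phi (om u0 + e) (k t))}.
      apply: (section_cont _ (fun=> om u0 + e)); last exact: cvg_cst.
      by apply: cPhi; rewrite ?ae ?kcd.
    have : \forall u \near u0, Phi (om u0 + e) (k u) < P.
      by apply: (cvgr_lt _ c1); rewrite -P0 decr // kcd.
    apply: filterS => u hu; rewrite ltNge; apply/negP.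
    have [/andP[au bu] Pu] := omP u.
    rewrite le_eqVlt => /predU1P[E|lt1]; first by move: hu; rewrite E Pu ltxx.
    by move: hu; rewrite -Pu ltNge ltW // decr // kcd.
  have lo : \forall u \near u0, om u0 - e < om u.
    have [lt|ge] := ltP (om u0 - e) a.
      by near=> u; have [/andP[/(lt_le_trans lt)->]] := omP u.
    have lt0 : om u0 - e < om u0 by rewrite ltrBlDr ltrDl.
    have be : om u0 - e <= b by rewrite (le_trans _ b0) // ltW.
    have c1 : {for u0, continuous (fun t => Phi (om u0 - e) (k t))}.
      apply: (section_cont _ (fun=> om u0 - e)); last exact: cvg_cst.
      by apply: cPhi; rewrite ?ge ?be ?kcd.
    have : \forall u \near u0, P < Phi (om u0 - e) (k u).
      by apply: (cvgr_gt _ c1); rewrite -P0 decr // kcd.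
    apply: filterS => u hu; rewrite ltNge; apply/negP.
    have [/andP[au bu] Pu] := omP u.
    rewrite le_eqVlt => /predU1P[E|lt1]; first by move: hu; rewrite -E Pu ltxx.
    by move: hu; rewrite -Pu ltNge ltW // decr // kcd.
  near=> u; have h1 : om u < om u0 + e by near: u.
  have h2 : om u0 - e < om u by near: u.
  rewrite ltr_distl; lra.
(* By strictness the curve starts at the corner [(b, c)], where [S] is at least [s]. *)
have omb : om c = b.
  have [/andP[ac bc]] := omP c; rewrite kid ?lexx // => E.
  move: bc; rewrite le_eqVlt => /predU1P[//|lt].
  by have := decr _ _ c ac lt (lexx _); rewrite lexx cd E Pbc ltxx => /(_ isT).
have [||u ucd E] := @IVT R (fun u => S (om u) (k u)) c d s cd.
- apply: continuous_subspaceT => u; apply: (section_cont S om); last exact: omc.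
  by apply: cS => //; case: (omP u).
- rewrite omb !kid ?lexx ?cd // ge_min le_max sbc /=.
  by rewrite Sd ?orbT //; case: (omP d).
- rewrite in_itv /= in ucd; exists (om u), u; have [h1 h2] := omP u.
  by move: E h2; rewrite kid.
Unshelve. all: end_near. Qed.
End ParametricCalculus.

(** * Orbits with given increments of angle and time *)

Section Orbits.
Context {R : realType}.
Implicit Types (X W mu z m : R).

(* The zero function when [f] has no antiderivative. *)
Definition antider (f : R -> R) : R -> R :=
  xget (fun=> 0) [set F | forall x : R, is_derive x 1 F (f x)].

Lemma antiderP (f : R -> R) : continuous f ->
  forall x : R, is_derive x 1 (antider f) (f x).
Proof. by move=> /antiderivative; apply: xgetPex. Qed.

(* With [N = 2 m / r] the orbit equation is
   [(dN/dphi)^2 = (N - A) (N - B) (N + A + B - 1)], where [A = 1 + W] is the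
   turning point and [B = 1 + (1 - mu) W]; substituting [N = inv_radius W z] it
   becomes [(dz/dphi)^2 = radicand W mu z / 4]. *)
Definition radicand W mu z : R := (mu + z ^+ 2) * (2 + W * (3 - mu + z ^+ 2)).

Definition inv_radius W z : R := 1 + W * (1 + z ^+ 2).

(** This is [dphi / dz] along the orbit. *)
Definition angle_rate W mu z : R := 2 / Num.sqrt (radicand W mu z).

(** This is [ds / dz] along the orbit. The square root in the numerator measures the conserved
    energy: [W ^ 2] times its argument is the value of the cubic [(N - A) (N - B) (N + A + B - 1)]
    at the horizon [N = 1]. *)
Definition time_rate m W mu z : R :=
  4 * m * Num.sqrt ((1 - mu) * (2 + (2 - mu) * W)) /
  ((1 + z ^+ 2) * inv_radius W z ^+ 2 * Num.sqrt (radicand W mu z)).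

(** With [X = 2 m / r - 1], this is the nonnegative [z] at which the orbit has radius [r]. *)
Definition endpoint X W : R := Num.sqrt (X / W - 1).

(** The orbit starts on the branch [z < 0], where [r] grows, and ends on the branch [z > 0], where
    [r] shrinks. *)
Definition increment (g : R -> R -> R -> R) X0 X1 W mu : R :=
  antider (g W mu) (endpoint X1 W) - antider (g W mu) (- endpoint X0 W).

(* Continuity in all variables, along an arbitrary filter so that it can be
   composed with moving end points. *)
Definition regular_rate (g : R -> R -> R -> R) := forall (T : Type)
    (F : set_system T) (FF : Filter F) (w u x : T -> R) W mu z,
  0 < W -> 0 < mu < 3 ->
  w @ F --> W -> u @ F --> mu -> x @ F --> z ->
  g (w t) (u t) (x t) @[t --> F] --> g W mu z.

Lemma regular_rate_continuous g W mu : regular_rate g -> 0 < W -> 0 < mu < 3 ->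
  continuous (g W mu).
Proof.
move=> rg W0 mu3 z.
by apply: (rg _ _ _ (fun=> W) (fun=> mu) id) => //; try exact: cvg_cst; exact: cvg_id.
Qed.

(** The range [0 < mu < 3] keeps both factors positive and is open, so that the boundary value
    [mu = 1] of the orbits is interior to it and continuity there makes sense. *)
Lemma radicand_gt0 W mu z : 0 < W -> 0 < mu < 3 -> 0 < radicand W mu z.
Proof.
move=> W0 /andP[mu0 mu3]; have z2 := sqr_ge0 z; apply: mulr_gt0; first by lra.
by rewrite addr_gt0 // mulr_gt0 //; lra.
Qed.

Lemma inv_radius_gt1 W z : 0 < W -> 1 < inv_radius W z.
Proof.
by move=> W0; rewrite /inv_radius ltrDl mulr_gt0 // ltr_pwDl // sqr_ge0.
Qed.

Lemma regular_sqrt_radicand :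
  regular_rate (fun W mu z => Num.sqrt (radicand W mu z)).
Proof.
move=> T F FF w u x W mu z W0 mu3 cw cu cx.
apply: (@continuous_cvg _ _ _ F FF (fun t => radicand (w t) (u t) (x t)) Num.sqrt).
  exact: sqrt_continuous.
have cx2 : x t ^+ 2 @[t --> F] --> z ^+ 2 by rewrite expr2; apply: cvgM.
apply: cvgM; first exact: (cvgD cu cx2).
apply: cvgD; first exact: cvg_cst.
apply: (cvgM cw); apply: cvgD; last exact: cx2.
by apply: cvgB; [exact: cvg_cst | exact: cu].
Qed.

Lemma regular_angle_rate : regular_rate angle_rate.
Proof.
move=> T F FF w u x W mu z W0 mu3 cw cu cx.
apply: cvgM; first exact: cvg_cst.
apply: cvgV; first by rewrite gt_eqF // sqrtr_gt0 radicand_gt0.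
exact: regular_sqrt_radicand.
Qed.

Lemma regular_time_rate m : regular_rate (time_rate m).
Proof.
move=> T F FF w u x W mu z W0 mu3 cw cu cx.
have cx2 : x t ^+ 2 @[t --> F] --> z ^+ 2 by rewrite expr2; apply: cvgM.
apply: cvgM.
  apply: cvgM; first exact: cvg_cst.
  apply: (@continuous_cvg _ _ _ F FF
    (fun t => (1 - u t) * (2 + (2 - u t) * w t)) Num.sqrt).
    exact: sqrt_continuous.
  apply: cvgM; first by apply: cvgB; [exact: cvg_cst | exact: cu].
  apply: cvgD; first exact: cvg_cst.
  by apply: cvgM; [apply: cvgB; [exact: cvg_cst | exact: cu] | exact: cw].
have N0 := inv_radius_gt1 z W0.
apply: cvgV.
  have z2 := sqr_ge0 z; apply: lt0r_neq0.
  apply: mulr_gt0; first apply: mulr_gt0.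
  - by rewrite ltr_pwDl.
  - by rewrite exprn_gt0 // (lt_trans ltr01).
  - by rewrite sqrtr_gt0 radicand_gt0.
have cN : inv_radius (w t) (x t) @[t --> F] --> inv_radius W z.
  apply: cvgD; first exact: cvg_cst.
  by apply: (cvgM cw); apply: cvgD; [exact: cvg_cst | exact: cx2].
apply: cvgM; last exact: regular_sqrt_radicand.
apply: cvgM; first by apply: cvgD => //; exact: cvg_cst.
by rewrite expr2; apply: cvgM.
Qed.

(** The affine substitution [pt] carries the moving interval of integration to [0, 1], which leaves
    only a dependence on parameters. *)
Lemma increment_jointly_continuous g X0 X1 W mu : regular_rate g ->
  0 < W -> 0 < mu < 3 ->
  {for (W, mu), continuous (fun q : R * R => increment g X0 X1 q.1 q.2)}.
Proof.
move=> rg W0 mu3.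
pose ell (w : R) := endpoint X0 w + endpoint X1 w.
pose pt (w y : R) := - endpoint X0 w + ell w * y.
pose H (q : R * R) y := antider (g q.1 q.2) (pt q.1 y).
pose G (q : R * R) y := g q.1 q.2 (pt q.1 y) * ell q.1.
have -> : (fun q : R * R => increment g X0 X1 q.1 q.2) =
    (fun q : R * R => H q 1 - H q 0).
  apply/funext => q; rewrite /H /pt /ell mulr1 mulr0 addr0.
  by rewrite addrA addNr add0r.
apply: (@parametric_increment_continuous R (R * R)%type (W, mu) H G).
  have : \forall q \near (W, mu), 0 < q.1 /\ 0 < q.2 < 3.
    move/andP: mu3 => [mu0 mu3].
    have c1 : q.1 @[q --> (W, mu)] --> W by exact: cvg_fst.
    have c2 : q.2 @[q --> (W, mu)] --> mu by exact: cvg_snd.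
    near=> q; split; first by near: q; exact: (cvgr_gt _ c1).
    apply/andP; split; near: q; [exact: (cvgr_gt _ c2)|exact: (cvgr_lt _ c2)].
  apply: filterS => q [q1 q2] y _.
  have dH := antiderP (regular_rate_continuous rg q1 q2) (pt q.1 y).
  have dpt : is_derive y 1 (pt q.1) (ell q.1).
    apply: is_derive_eq; rewrite /GRing.scale /=; ring.
  exact: (is_derive1_comp dH dpt).
move=> y _.
have c1 : q.1.1 @[q --> ((W, mu), y)] --> W.
  exact: (cvg_comp _ _ (@cvg_fst _ _ (nbhs (W, mu)) (nbhs y) _)
    (@cvg_fst _ _ (nbhs W) (nbhs mu) _)).
have c2 : q.1.2 @[q --> ((W, mu), y)] --> mu.
  exact: (cvg_comp _ _ (@cvg_fst _ _ (nbhs (W, mu)) (nbhs y) _)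
    (@cvg_snd _ _ (nbhs W) (nbhs mu) _)).
have c3 : q.2 @[q --> ((W, mu), y)] --> y by exact: cvg_snd.
have cend X : endpoint X q.1.1 @[q --> ((W, mu), y)] --> endpoint X W.
  apply: (@continuous_cvg _ _ _ _ _ (fun q : R * R * R => X / q.1.1 - 1) Num.sqrt).
    exact: sqrt_continuous.
  apply: cvgB; last exact: cvg_cst.
  apply: cvgM; first exact: cvg_cst.
  by apply: cvgV; rewrite ?gt_eqF.
have cell : ell q.1.1 @[q --> ((W, mu), y)] --> ell W by apply: cvgD; exact: cend.
apply: cvgM => //; apply: rg => //.
by apply: cvgD; [apply: cvgN; exact: cend|apply: cvgM].
Unshelve. all: end_near. Qed.

End Orbits.

(** * Monotonicity and growth of the increments of angle and time *)

Section OrbitIncrements.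
Context {R : realType}.
Implicit Types (X W mu z m : R).

Lemma endpoint_gt0 X W : 0 < W < X -> 0 < endpoint X W.
Proof. by move=> /andP[W0 WX]; rewrite sqrtr_gt0 subr_gt0 ltr_pdivlMr ?mul1r. Qed.

Lemma sqr_endpoint X W : 0 < W < X -> W * (1 + endpoint X W ^+ 2) = X.
Proof.
move=> /andP[W0 WX]; rewrite sqr_sqrtr; first by field; rewrite gt_eqF.
by rewrite subr_ge0 ler_pdivlMr ?mul1r ?ltW.
Qed.

Lemma endpoint_decr X W W' : 0 < W -> W < W' -> W' < X ->
  endpoint X W' < endpoint X W.
Proof.
move=> W0 WW' WX; have W'0 := lt_trans W0 WW'.
have pos w : 0 < w -> w < X -> 0 < X / w - 1.
  by move=> w0 wX; rewrite subr_gt0 ltr_pdivlMr ?mul1r.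
rewrite ltr_sqrt ?pos ?(lt_trans WW') // ltrD2r ltr_pM2l ?(lt_trans W'0) //.
by rewrite ltf_pV2.
Qed.

Lemma angle_rate_gt0 W mu z : 0 < W -> 0 < mu < 3 -> 0 < angle_rate W mu z.
Proof. by move=> *; rewrite divr_gt0 // sqrtr_gt0 radicand_gt0. Qed.

Lemma antider_angle_rate W mu : 0 < W -> 0 < mu < 3 ->
  forall z, is_derive z 1 (antider (angle_rate W mu)) (angle_rate W mu z).
Proof.
move=> W0 mu3; apply/antiderP/regular_rate_continuous => //.
exact: regular_angle_rate.
Qed.

Lemma antider_time_rate m W mu : 0 < W -> 0 < mu < 3 ->
  forall z, is_derive z 1 (antider (time_rate m W mu)) (time_rate m W mu z).
Proof.
move=> W0 mu3; apply/antiderP/regular_rate_continuous => //.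
exact: regular_time_rate.
Qed.

Lemma angle_rate_le W W' mu mu' z : 0 < W -> W <= W' ->
  0 < mu -> mu <= mu' -> mu' <= 1 ->
  angle_rate W' mu' z <= angle_rate W mu z.
Proof.
move=> W0 WW' mu0 mumu' mu'1; have z2 := sqr_ge0 z.
have p1 : 0 < radicand W mu z by apply: radicand_gt0 => //; lra.
have p2 : 0 < radicand W' mu' z by apply: radicand_gt0; lra.
rewrite ler_pM2l // lef_pV2 ?posrE ?sqrtr_gt0 // ler_sqrt ?(ltW p2) //.
apply: (@le_trans _ _ (radicand W mu' z)).
  rewrite /radicand.
  have -> : (mu' + z ^+ 2) * (2 + W * (3 - mu' + z ^+ 2)) =
    (mu + z ^+ 2) * (2 + W * (3 - mu + z ^+ 2)) +
      (mu' - mu) * (2 + W * (3 - mu - mu')) by ring.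
  by rewrite lerDl mulr_ge0 ?subr_ge0 // addr_ge0 // mulr_ge0 //; lra.
rewrite /radicand ler_pM2l; last by lra.
by rewrite lerD2l ler_wpM2r //; lra.
Qed.

Local Notation angle := (increment angle_rate).

(** A larger [W] lowers the integrand and strictly shortens the interval at both ends. *)
Lemma angle_decrW X0 X1 W W' mu : 0 < W -> W < W' -> W' < X0 -> W' < X1 ->
  0 < mu <= 1 -> angle X0 X1 W' mu < angle X0 X1 W mu.
Proof.
move=> W0 WW' WX0 WX1 /andP[mu0 mu1]; have W'0 := lt_trans W0 WW'.
have mu3 : 0 < mu < 3 by lra.
have d := antider_angle_rate W0 mu3; have d' := antider_angle_rate W'0 mu3.
have e0 := endpoint_decr W0 WW' WX0; have e1 := endpoint_decr W0 WW' WX1.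
have p0 : 0 < endpoint X0 W' by apply: endpoint_gt0; rewrite W'0.
have p1 : 0 < endpoint X1 W' by apply: endpoint_gt0; rewrite W'0.
have h : angle X0 X1 W' mu <= antider (angle_rate W mu) (endpoint X1 W') -
    antider (angle_rate W mu) (- endpoint X0 W').
  apply: (derive_le_increment (df := angle_rate W' mu) (dg := angle_rate W mu)) => //.
    by lra.
  by move=> z _; apply: angle_rate_le; lra.
have h1 : antider (angle_rate W mu) (endpoint X1 W') <
    antider (angle_rate W mu) (endpoint X1 W).
  by apply: (derive_gt0_lt (df := angle_rate W mu)) => // z _; exact: angle_rate_gt0.
have h0 : antider (angle_rate W mu) (- endpoint X0 W) <
    antider (angle_rate W mu) (- endpoint X0 W').
  by apply: (derive_gt0_lt (df := angle_rate W mu)) => //;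
    [lra | move=> z _; exact: angle_rate_gt0].
rewrite (le_lt_trans h) // /increment; lra.
Qed.

Lemma angle_decr_mu X0 X1 W mu mu' : 0 < W < X0 -> W < X1 ->
  0 < mu -> mu <= mu' -> mu' <= 1 -> angle X0 X1 W mu' <= angle X0 X1 W mu.
Proof.
move=> /andP[W0 WX0] WX1 mu0 mumu' mu'1.
have p0 : 0 < endpoint X0 W by apply: endpoint_gt0; rewrite W0.
have p1 : 0 < endpoint X1 W by apply: endpoint_gt0; rewrite W0.
apply: (derive_le_increment (df := angle_rate W mu') (dg := angle_rate W mu)).
- by lra.
- by move=> z _; apply: antider_angle_rate => //; lra.
- by move=> z _; apply: antider_angle_rate => //; lra.
- by move=> z _; apply: angle_rate_le.
Qed.

(** For [0 <= z <= endpoint X1 W] the factors of the radicand at [mu = e ^ 2] are at most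
    [(e + z) ^ 2] and [2 + 3 X1], so the integrand dominates a multiple of [1 / (e + z)]. The half
    [z <= 0] is discarded. *)
Lemma angle_ge_ln X0 X1 W e : 0 < W < X0 -> W < X1 -> 0 < e <= 1 ->
  2 / Num.sqrt (2 + 3 * X1) * ln (1 + endpoint X1 W / e) <= angle X0 X1 W (e ^+ 2).
Proof.
move=> /andP[W0 WX0] WX1 /andP[e0 e1].
have W1 : 0 < W < X1 by rewrite W0.
have p0 : 0 < endpoint X0 W by apply: endpoint_gt0; rewrite W0.
have p1 : 0 < endpoint X1 W by apply: endpoint_gt0.
have mu0 : 0 < e ^+ 2 by rewrite exprn_gt0.
have mu1 : e ^+ 2 <= 1 by rewrite exprn_ile1 // ltW.
have mu3 : 0 < e ^+ 2 < 3 by lra.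
set c := 2 / _; set A := antider (angle_rate W (e ^+ 2)).
have c0 : 0 < c by rewrite divr_gt0 // sqrtr_gt0; lra.
have h0 : A (- endpoint X0 W) <= A 0.
  apply: (derive_ge0_le (df := angle_rate W (e ^+ 2))); first by lra.
    by move=> z _; exact: antider_angle_rate.
  by move=> z _; apply/ltW/angle_rate_gt0.
suff : c * ln (e + endpoint X1 W) - c * ln (e + 0) <= A (endpoint X1 W) - A 0.
  rewrite addr0 -mulrBr -ln_div ?posrE //; last by lra.
  by rewrite mulrDl divff ?gt_eqF // /increment -/A; lra.
apply: (derive_le_increment (f := fun z => c * ln (e + z)) (df := fun z => c * (e + z)^-1)
  (dg := angle_rate W (e ^+ 2))) => //.
- exact: ltW.
- move=> z /andP[z0 _]; have ez : 0 < e + z by lra.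
  have dln := is_derive1_ln ez.
  by apply: is_derive_eq; rewrite /GRing.scale /=; ring.
- by move=> z _; exact: antider_angle_rate.
move=> z /andP[z0 zZ]; rewrite /c /angle_rate -mulrA ler_pM2l // -invfM.
have ez : 0 < e + z by lra.
have C0 : 0 < 2 + 3 * X1 by lra.
have r0 : 0 < radicand W (e ^+ 2) z by exact: radicand_gt0.
rewrite mulrC lef_pV2 ?posrE ?mulr_gt0 ?sqrtr_gt0 //.
rewrite -[e + z]gtr0_norm // -sqrtr_sqr -sqrtrM ?sqr_ge0 //.
rewrite ler_sqrt; last by rewrite mulr_ge0 ?sqr_ge0 ?ltW.
rewrite /radicand; apply: ler_pM.
- by rewrite addr_ge0 ?sqr_ge0 // ltW.
- by rewrite addr_ge0 // mulr_ge0 ?(ltW W0) // addr_ge0 ?sqr_ge0 //; lra.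
- by rewrite sqrrD lerD2r lerDl mulrn_wge0 // mulr_ge0 // ltW.
rewrite lerD2l; have := sqr_endpoint W1.
have zz : z ^+ 2 <= endpoint X1 W ^+ 2 by rewrite ler_sqr ?nnegrE // ltW.
have hz : W * (1 + z ^+ 2) <= W * (1 + endpoint X1 W ^+ 2).
  by rewrite ler_wpM2l ?(ltW W0) // lerD2l.
have hW : W * (2 - e ^+ 2) <= W * 2 by rewrite ler_wpM2l ?(ltW W0) //; lra.
have -> : W * (3 - e ^+ 2 + z ^+ 2) = W * (1 + z ^+ 2) + W * (2 - e ^+ 2) by ring.
move=> E; rewrite E in hz; lra.
Qed.

Lemma angle_unbounded_mu X0 X1 W (P : R) : 0 < W < X0 -> W < X1 ->
  exists mu, 0 < mu <= 2^-1 /\ P <= angle X0 X1 W mu.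
Proof.
move=> W0 W1; set c := 2 / Num.sqrt (2 + 3 * X1).
have X1p : 0 < X1 by lra.
have c0 : 0 < c by rewrite divr_gt0 // sqrtr_gt0; lra.
have p1 : 0 < endpoint X1 W by apply: endpoint_gt0; lra.
(* The second term makes the logarithm of [angle_ge_ln] at least [P / c]; the first keeps
   [mu = e ^ 2] below 1/2. *)
pose e := Num.min (2^-1 : R) (endpoint X1 W / expR (P / c)).
have e0 : 0 < e by rewrite /e lt_min divr_gt0 ?expR_gt0 ?invr_gt0 ?ltr0n.
have e2 : e <= 2^-1 by rewrite ge_min lexx.
exists (e ^+ 2); split.
  rewrite exprn_gt0 //=; have : e ^+ 2 <= 2^-1 ^+ 2.
    by rewrite ler_sqr ?nnegrE ?(ltW e0) //; lra.
  by rewrite expr2 -/(_ ^+ 2) [2^-1 ^+ 2]expr2; lra.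
apply: (le_trans _ (angle_ge_ln W0 W1 _)); last by lra.
rewrite -/c mulrC -ler_pdivrMr // -[P / c]expRK ler_ln ?posrE ?expR_gt0 //.
  have : expR (P / c) <= endpoint X1 W / e.
    by rewrite ler_pdivlMr // mulrC -ler_pdivlMr ?expR_gt0 // ge_min lexx orbT.
  by lra.
by rewrite addr_gt0 // divr_gt0.
Qed.

Lemma angle_unbounded_W X0 X1 Wmax (P : R) : 0 < Wmax < X0 -> Wmax < X1 ->
  exists W, 0 < W <= Wmax /\ P <= angle X0 X1 W 1.
Proof.
move=> W0 W1; set c := 2 / Num.sqrt (2 + 3 * X1).
have X1p : 0 < X1 by lra.
have c0 : 0 < c by rewrite divr_gt0 // sqrtr_gt0; lra.
set q := expR (P / c).
have q0 : 0 < q by exact: expR_gt0.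
have q1 : 0 < 1 + q ^+ 2 by rewrite addr_gt0 // exprn_gt0.
(* The second term makes [endpoint X1 W] at least [q], hence the logarithm with [e = 1] at least
   [P / c]. *)
pose W := Num.min Wmax (X1 / (1 + q ^+ 2)).
have Wp : 0 < W by rewrite /W lt_min divr_gt0 // andbT; lra.
have Wm : W <= Wmax by rewrite ge_min lexx.
exists W; split; first by lra.
have := @angle_ge_ln X0 X1 W 1; rewrite expr1n => h.
apply: (le_trans _ (h _ _ _)); [|lra..].
rewrite -/c divr1 mulrC -ler_pdivrMr // -[P / c]expRK ler_ln ?posrE ?expR_gt0 //.
  suff : q <= endpoint X1 W by rewrite -/q; lra.
  rewrite -[q]gtr0_norm // -sqrtr_sqr ler_sqrt; last first.
    by rewrite subr_ge0 ler_pdivlMr // mul1r; lra.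
  rewrite lerBrDl ler_pdivlMr // mulrC -ler_pdivlMr //.
  by rewrite ge_min lexx orbT.
by rewrite addr_gt0 //; apply: endpoint_gt0; lra.
Qed.

(** The quotient of the two rates is [2 m] times the square root in [time_rate], divided by
    [(1 + z ^ 2) N ^ 2]. The root is at least 1 for [mu <= 1/2], and on the whole interval
    [W (1 + z ^ 2)] is at most [X0 + X1]. *)
Lemma time_ge_angle m X0 X1 W mu : 0 < m -> 0 < W < X0 -> W < X1 -> 0 < mu <= 2^-1 ->
  2 * m / ((X0 + X1) / W * (1 + (X0 + X1)) ^+ 2) * angle X0 X1 W mu
    <= increment (time_rate m) X0 X1 W mu.
Proof.
move=> m0 /andP[W0 WX0] WX1 mu2; set k := 2 * m / _.
have mu3 : 0 < mu < 3 by lra.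
have p0 : 0 < endpoint X0 W by apply: endpoint_gt0; rewrite W0.
have p1 : 0 < endpoint X1 W by apply: endpoint_gt0; rewrite W0.
have E0 : W * (1 + endpoint X0 W ^+ 2) = X0 by apply: sqr_endpoint; rewrite W0.
have E1 : W * (1 + endpoint X1 W ^+ 2) = X1 by apply: sqr_endpoint; rewrite W0.
rewrite /increment mulrBr.
apply: (derive_le_increment (f := fun z => k * antider (angle_rate W mu) z)
  (df := fun z => k * angle_rate W mu z) (dg := time_rate m W mu)).
- by lra.
- move=> z _; have := antider_angle_rate W0 mu3 z => d.
  by apply: is_derive_eq.
- by move=> z _; exact: antider_time_rate.
move=> z zz.
set D := Num.sqrt (radicand W mu z).
have D0 : 0 < D by rewrite sqrtr_gt0 radicand_gt0.
have z1 : 0 < 1 + z ^+ 2 by rewrite ltr_pwDl // sqr_ge0.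
have N1 := inv_radius_gt1 z W0; set N := inv_radius W z in N1 *.
have Wz : W * (1 + z ^+ 2) <= X0 + X1.
  have [z0|z0] := leP 0 z.
    have : W * (1 + z ^+ 2) <= X1.
      by rewrite -E1 ler_pM2l // lerD2l ler_sqr ?nnegrE //; lra.
    by lra.
  have : W * (1 + z ^+ 2) <= X0.
    by rewrite -E0 ler_pM2l // lerD2l -[z ^+ 2]sqrrN ler_sqr ?nnegrE //; lra.
  by lra.
have B : (1 + z ^+ 2) * N ^+ 2 <= (X0 + X1) / W * (1 + (X0 + X1)) ^+ 2.
  apply: ler_pM; [exact: ltW | exact: sqr_ge0 | by rewrite ler_pdivlMr // mulrC |].
  have NX : N <= 1 + (X0 + X1) by rewrite lerD2l.
  by rewrite ler_sqr ?nnegrE //; lra.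
have S1 : 1 <= Num.sqrt ((1 - mu) * (2 + (2 - mu) * W)).
  rewrite -[leLHS]sqrtr1 ler_sqrt; last first.
    by rewrite mulr_ge0 //; [lra|rewrite addr_ge0 // mulr_ge0 //; lra].
  rewrite -[leLHS](@mulVf _ 2) //; apply: ler_pM => //; try lra.
  by rewrite lerDl mulr_ge0 //; lra.
have B0 : 0 < (1 + z ^+ 2) * N ^+ 2 by rewrite mulr_gt0 // exprn_gt0; lra.
rewrite /time_rate /angle_rate -/D -/N /k.
have -> : 4 * m * Num.sqrt ((1 - mu) * (2 + (2 - mu) * W)) /
    ((1 + z ^+ 2) * N ^+ 2 * D) =
  2 * m * (Num.sqrt ((1 - mu) * (2 + (2 - mu) * W)) / ((1 + z ^+ 2) * N ^+ 2)) *
    (2 / D).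
  by field; rewrite !gt_eqF //; lra.
rewrite ler_pM2r ?divr_gt0 // ler_pM2l ?mulr_gt0 //.
rewrite -[leLHS]mul1r; apply: ler_pM => //.
  by rewrite invr_ge0 (le_trans _ B) // ltW.
by rewrite lef_pV2 ?posrE // (lt_le_trans _ B).
Qed.

Lemma time_mu1 m X0 X1 W : 0 < W < X0 -> W < X1 ->
  increment (time_rate m) X0 X1 W 1 = 0.
Proof.
move=> /andP[W0 WX0] WX1.
have p0 : 0 < endpoint X0 W by apply: endpoint_gt0; rewrite W0.
have p1 : 0 < endpoint X1 W by apply: endpoint_gt0; rewrite W0.
apply/eqP; rewrite subr_eq0; apply/eqP; apply: derive0_constant; first by lra.
move=> z _; have : is_derive z 1 (antider (time_rate m W 1)) (time_rate m W 1 z).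
  by apply: antider_time_rate => //; lra.
by rewrite /time_rate subrr mul0r sqrtr0 mulr0 mul0r.
Qed.

(** The level curve of angle [P = d + 2 pi k] is followed in the rectangle [[W1, V] x [mu, 1]], from
    the corner [(V, mu)], where the time increment is at least [s], to the side [mu = 1], where it
    vanishes. *)
Lemma exists_orbit m X0 X1 (d s : R) : 0 < m -> 0 < X0 -> 0 < X1 -> 0 <= s ->
  exists W mu (k : nat), [/\ 0 < W < X0, W < X1, 0 < mu <= 1,
    angle X0 X1 W mu = d + 2 * pi * k%:R &
    increment (time_rate m) X0 X1 W mu = s].
Proof.
move=> m0 X0p X1p s0.
pose V : R := Num.min X0 X1 / 2.
have [V0 VX0 VX1] : [/\ 0 < V, V < X0 & V < X1].
  have M0 : 0 < Num.min X0 X1 by rewrite lt_min X0p.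
  have : Num.min X0 X1 <= X0 by rewrite ge_min lexx.
  have : Num.min X0 X1 <= X1 by rewrite ge_min lexx orbT.
  by rewrite /V; split; lra.
have VX : 0 < V < X0 by rewrite V0.
set kappa := 2 * m / ((X0 + X1) / V * (1 + (X0 + X1)) ^+ 2).
have kappa0 : 0 < kappa.
  by rewrite divr_gt0 ?mulr_gt0 ?invr_gt0 ?exprn_gt0 //; lra.
(* [P] must exceed the angle at [(V, 1/2)], so that it is attained at [V] for some [mu <= 1/2], and
   exceed [s / kappa], so that the time increment there is at least [s]. *)
pose B := Num.max (angle X0 X1 V 2^-1) (s / kappa).
have pi0 := pi_gt0 R.
pose k := (Num.truncn (`|B - d| / (2 * pi))).+1.
pose P := d + 2 * pi * k%:R.
have BP : B <= P.
  have : `|B - d| / (2 * pi) < k%:R by exact: truncnS_gt.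
  rewrite ltr_pdivrMr ?mulr_gt0 // mulrC => h.
  by have := ler_norm (B - d); rewrite /P; lra.
have P1 : angle X0 X1 V 2^-1 <= P by apply: le_trans BP; rewrite le_max lexx.
have P2 : s <= kappa * P.
  by rewrite -ler_pdivrMl // mulrC (le_trans _ BP) // le_max lexx orbT.
have [mu0 [mu0p mu0P]] := angle_unbounded_mu P VX VX1.
have [|||mu] := @IVT R (fun mu => angle X0 X1 V mu) mu0 2^-1 P.
- by lra.
- apply: continuous_in_subspaceT => u; rewrite inE /= in_itv /= => uab.
  have u3 : 0 < u < 3 by lra.
  exact: (cvg_comp (fun w => (V, w)) (fun q : R * R => angle X0 X1 q.1 q.2)
    (cvg_pair (cvg_cst V) (@cvg_id _ (nbhs u)))
    (@increment_jointly_continuous _ _ X0 X1 _ _ regular_angle_rate V0 u3)).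
- by rewrite ge_min le_max mu0P P1 orbT.
rewrite in_itv /= => mup muP.
(* The angle is at least [P] at [(W1, 1)], hence on the whole side [W = W1], because it decreases in
   [mu]. *)
have [W1 [W1p W1P]] := angle_unbounded_W P VX VX1.
have [|||||||||W [u [Wp up E1 E2]]] := @level_curve_ivt R (angle X0 X1)
  (increment (time_rate m) X0 X1) W1 V mu 1 P s.
- by lra.
- by lra.
- move=> w u hw hu; apply: increment_jointly_continuous; [|lra..].
  exact: regular_angle_rate.
- move=> w u hw hu; apply: increment_jointly_continuous; [|lra..].
  exact: regular_time_rate.
- by move=> w w' u *; apply: angle_decrW => //; lra.
- move=> u hu; apply/andP; split.
    by rewrite -muP; apply: angle_decr_mu => //; lra.
  by apply: (le_trans W1P); apply: angle_decr_mu => //; lra.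
- by [].
- by apply: (le_trans P2); rewrite -muP; apply: time_ge_angle => //; lra.
- by move=> w hw; rewrite time_mu1 //; lra.
by exists W, u, k; split => //; lra.
Qed.

End OrbitIncrements.

(** * Geodesic equation *)

Section DiagonalMetric.
Context {R : realType}.

Lemma invmx_diag n (d : 'rV[R]_n) : (forall k, d 0 k != 0) ->
  invmx (diag_mx d) = diag_mx (map_mx GRing.inv d).
Proof.
move=> d0; have E : diag_mx d *m diag_mx (map_mx GRing.inv d) = 1%:M.
  rewrite mulmx_diag; apply/matrixP => i j; rewrite !mxE.
  by case: eqP => // _; rewrite divff.
have [U _] := mulmx1_unit E.
by rewrite -[RHS]mul1mx -(mulVmx U) -mulmxA E mulmx1.
Qed.

Lemma partial_diag n (d : 'rV[R]_n -> 'rV[R]_n) i j l x :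
  partial i (fun y => diag_mx (d y) j l) x =
  partial i (fun y => d y 0 j) x *+ (j == l).
Proof.
rewrite /partial; under eq_fun do rewrite mxE.
by case: eqP => _; [rewrite mulr1n | rewrite mulr0n; exact: derive_cst].
Qed.

Lemma christoffel_diag n (d : 'rV[R]_n -> 'rV[R]_n) x k i j :
  (forall k, d x 0 k != 0) ->
  christoffel (fun y => diag_mx (d y)) x k i j =
  2^-1 * ((d x 0 k)^-1 * (partial i (fun y => d y 0 k) x *+ (j == k)
    + partial j (fun y => d y 0 k) x *+ (i == k)
    - partial k (fun y => d y 0 i) x *+ (i == j))).
Proof.
move=> d0; rewrite /christoffel invmx_diag //; congr (_ * _).
rewrite (bigD1 k) //= big1 => [|l lk]; last first.
  by rewrite !mxE eq_sym (negPf lk) mulr0n mul0r.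
rewrite addr0.
have -> : diag_mx (map_mx GRing.inv (d x)) k k = (d x 0 k)^-1.
  by rewrite !mxE eqxx mulr1n.
rewrite (partial_diag d i j k x) (partial_diag d j i k x) (partial_diag d k i j x).
have -> : partial i (fun y => d y 0 j) x *+ (j == k) =
    partial i (fun y => d y 0 k) x *+ (j == k) by case: eqP => [->|].
have -> : partial j (fun y => d y 0 i) x *+ (i == k) =
    partial j (fun y => d y 0 k) x *+ (i == k) by case: eqP => [->|].
by [].
Qed.

(** Contracted twice with the same vector, the first two terms of the Christoffel symbol contribute
    equally, which cancels the factor 1/2 in front of them. *)
Lemma christoffel_diag_sum n (d : 'rV[R]_n -> 'rV[R]_n) x (v : 'I_n -> R) k :
  (forall k, d x 0 k != 0) ->
  \sum_(i < n) \sum_(j < n)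
     christoffel (fun y => diag_mx (d y)) x k i j * v i * v j =
  (d x 0 k)^-1 * (v k * (\sum_(i < n) partial i (fun y => d y 0 k) x * v i)
    - 2^-1 * \sum_(i < n) partial k (fun y => d y 0 i) x * v i ^+ 2).
Proof.
move=> d0; pose p i j := partial i (fun y => d y 0 j) x.
have S1 : \sum_(i < n) \sum_(j < n) (p i k *+ (j == k)) * v i * v j =
    v k * \sum_(i < n) p i k * v i.
  rewrite mulr_sumr; apply: eq_bigr => i _; rewrite (bigD1 k) //= big1 => [|j jk].
    by rewrite eqxx mulr1n addr0 mulrC.
  by rewrite (negPf jk) mulr0n !mul0r.
have S2 : \sum_(i < n) \sum_(j < n) (p j k *+ (i == k)) * v i * v j =
    v k * \sum_(i < n) p i k * v i.
  rewrite exchange_big -S1; apply: eq_bigr => i _; apply: eq_bigr => j _; ring.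
have S3 : \sum_(i < n) \sum_(j < n) (p k i *+ (i == j)) * v i * v j =
    \sum_(i < n) p k i * v i ^+ 2.
  apply: eq_bigr => i _; rewrite (bigD1 i) //= big1 => [|j ji].
    by rewrite eqxx mulr1n addr0 -mulrA -expr2.
  by rewrite eq_sym (negPf ji) mulr0n !mul0r.
transitivity (2^-1 * (d x 0 k)^-1 *
    (\sum_(i < n) \sum_(j < n) (p i k *+ (j == k)) * v i * v j
     + \sum_(i < n) \sum_(j < n) (p j k *+ (i == k)) * v i * v j
     - \sum_(i < n) \sum_(j < n) (p k i *+ (i == j)) * v i * v j)).
  rewrite -big_split -sumrB mulr_sumr; apply: eq_bigr => i _.
  rewrite -big_split -sumrB mulr_sumr; apply: eq_bigr => j _ /=.
  by rewrite christoffel_diag // /p; ring.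
rewrite S1 S2 S3 -/p; field; exact: d0.
Qed.

(** A criterion with explicit velocity and acceleration in place of [derive1]. The velocity is
    needed near [t], since it is differentiated again; the acceleration only at [t]. *)
Lemma geodesic_equation_diag n (d : 'rV[R]_n -> 'rV[R]_n) (u u1 : R -> 'rV[R]_n)
    (u2 : 'I_n -> R) (p : 'I_n -> 'I_n -> R) (t : R) :
  (forall k, d (u t) 0 k != 0) ->
  (forall i j, partial i (fun y => d y 0 j) (u t) = p i j) ->
  (\forall s \near t, forall k, is_derive (s : R) 1 (fun s => u s 0 k) (u1 s 0 k)) ->
  (forall k, is_derive t 1 (fun s => u1 s 0 k) (u2 k)) ->
  (forall k, u2 k + (d (u t) 0 k)^-1 * (u1 t 0 k * (\sum_(i < n) p i k * u1 t 0 i)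
    - 2^-1 * \sum_(i < n) p k i * u1 t 0 i ^+ 2) = 0) ->
  geodesic_equation (fun y => diag_mx (d y)) u t.
Proof.
move=> d0 dp du du1 E; rewrite /geodesic_equation /= => k.
have near1 j : \forall s \near t, u1 s 0 j = derive1 (fun s => u s 0 j) s.
  by apply: filterS du => s /(_ j) h; rewrite derive1E derive_val.
have h2 : is_derive t 1 (derive1 (fun s => u s 0 k)) (u2 k).
  exact: (near_eq_is_derive (near1 k) (du1 k)).
split.
- by have := nbhs_singleton du k => -[].
- by case: h2.
rewrite derive1E (derive_val (f := derive1 _)) christoffel_diag_sum //.
rewrite -[RHS](E k) -(nbhs_singleton (near1 k)).
congr (_ + _ * (_ * _ - _ * _)); apply: eq_bigr => i _;
  by rewrite dp -(nbhs_singleton (near1 i)).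
Qed.

(** Reduces partial derivatives to derivatives in one variable. *)
Lemma derive_line n (f : 'rV[R]_n -> R) x v l :
  is_derive (0 : R) 1 (fun h => f (h *: v + x)) l -> 'D_v f x = l.
Proof.
move=> [_ <-]; rewrite /derive.
have -> // : (fun h => h^-1 *: ((f \o shift x) (h *: v) - f x)) =
  (fun h => h^-1 *: (((fun h => f (h *: v + x)) \o shift 0) (h *: 1) - f (0 *: v + x))).
apply/funext => h /=.
by rewrite scale0r add0r addr0 [h *: 1]mulr1.
Qed.

End DiagonalMetric.

(** * Great circles *)

Section GreatCircles.
Context {R : realType}.
Implicit Types (Q : 'M[R]_3) (x y : 'rV[R]_3).

Definition matrix3 (s : seq (seq R)) : 'M[R]_3 := \matrix_(i, j) (nth [::] s i)`_j.

(* The rows are the unit vectors [e_r], [e_phi], [- e_theta]. *)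
Definition frame (theta phi : R) : 'M[R]_3 := matrix3
  [:: [:: sin theta * cos phi; sin theta * sin phi; cos theta];
      [:: - sin phi; cos phi; 0];
      [:: - (cos theta * cos phi); - (cos theta * sin phi); sin theta]].

(** A rotation about the first axis, which fixes [equator 0]. *)
Definition roll (alpha : R) : 'M[R]_3 := matrix3
  [:: [:: 1; 0; 0]; [:: 0; cos alpha; sin alpha]; [:: 0; - sin alpha; cos alpha]].

Definition equator (phi : R) : 'rV[R]_3 := spherical (pi / 2) phi.

Lemma ord3P (P : 'I_3 -> Prop) : P 0 -> P 1 -> P 2 -> forall i, P i.
Proof.
move=> P0 P1 P2 [[|[|[|//]]] h].
- by move: P0; congr (P _); apply: val_inj.
- by move: P1; congr (P _); apply: val_inj.
- by move: P2; congr (P _); apply: val_inj.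
Qed.

Lemma equatorE phi : equator phi = \row_k [:: cos phi; sin phi; 0]`_k.
Proof. by rewrite /equator /spherical sin_pihalf cos_pihalf !mul1r. Qed.

Lemma frame_orthogonal theta phi : frame theta phi *m (frame theta phi)^T = 1%:M.
Proof.
have h1 := cos2Dsin2 theta; have h2 := cos2Dsin2 phi.
have c1 : cos theta ^+ 2 = 1 - sin theta ^+ 2 by rewrite -h1 addrK.
have c2 : cos phi ^+ 2 = 1 - sin phi ^+ 2 by rewrite -h2 addrK.
apply/matrixP; elim/ord3P; elim/ord3P;
  rewrite !mxE !big_ord_recl big_ord0 !mxE /=; ring: c1 c2.
Qed.

Lemma roll_orthogonal alpha : roll alpha *m (roll alpha)^T = 1%:M.
Proof.
have h1 := cos2Dsin2 alpha.
have c1 : cos alpha ^+ 2 = 1 - sin alpha ^+ 2 by rewrite -h1 addrK.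
apply/matrixP; elim/ord3P; elim/ord3P;
  rewrite !mxE !big_ord_recl big_ord0 !mxE /=; ring: c1.
Qed.

Lemma spherical_frame theta phi : spherical theta phi = equator 0 *m frame theta phi.
Proof.
rewrite equatorE cos0 sin0; apply/rowP; elim/ord3P;
  rewrite !mxE !big_ord_recl big_ord0 !mxE /=; ring.
Qed.

(** [frame (pi / 2) phi] is the rotation by [phi] about the third axis. It serves to centre a chart
    at any point of the great circle. *)
Lemma equatorD psi phi : equator (psi + phi) = equator psi *m frame (pi / 2) phi.
Proof.
rewrite !equatorE cosD sinD; apply/rowP; elim/ord3P;
  rewrite !mxE !big_ord_recl big_ord0 !mxE /= ?sin_pihalf ?cos_pihalf; ring.
Qed.

Lemma equatorD2pin phi (k : nat) : equator (phi + 2 * pi * k%:R) = equator phi.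
Proof.
have -> : phi + 2 * pi * k%:R = phi + (pi *+ 2) *+ k.
  by rewrite -[in RHS]mulr_natr -[pi *+ 2]mulr_natr [pi * 2]mulrC.
by rewrite !equatorE (periodicn (@cosD2pi R)) (periodicn (@sinD2pi R)).
Qed.

Lemma mulmx_orthogonal Q Q' : Q *m Q^T = 1%:M -> Q' *m Q'^T = 1%:M ->
  (Q *m Q') *m (Q *m Q')^T = 1%:M.
Proof. by move=> h h'; rewrite trmx_mul mulmxA -(mulmxA Q) h' mulmx1. Qed.

Lemma unit_circle (a b : R) : a ^+ 2 + b ^+ 2 = 1 ->
  exists alpha, a = cos alpha /\ b = sin alpha.
Proof.
move=> ab; have a2 : a ^+ 2 <= 1 by have := sqr_ge0 b; lra.
have a1 : -1 <= a <= 1.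
  by rewrite -ler_norml -(@expr_le1 _ 2) // -normrX ger0_norm ?sqr_ge0.
have [_ ca] := acos_def a1.
have sa : sin (acos a) = `|b|.
  by rewrite sin_acos // -sqrtr_sqr -ab addrC addKr.
have [b0|b0] := leP 0 b.
  by exists (acos a); rewrite ca sa ger0_norm.
by exists (- acos a); rewrite cosN sinN ca sa ltr0_norm // opprK.
Qed.

(** A frame carries [equator 0] to [x0]; a roll about that point then turns the equator until it
    passes through [x1]. *)
Lemma great_circle x0 x1 : sphere2 x0 -> sphere2 x1 ->
  exists Q delta, [/\ Q *m Q^T = 1%:M, x0 = equator 0 *m Q & x1 = equator delta *m Q].
Proof.
move=> /spherical_cover[Q [theta [phi [hQ _ _ ->]]]] hx1.
pose Q0 := frame theta phi *m Q.
have hQ0 : Q0 *m Q0^T = 1%:M by apply: mulmx_orthogonal => //; exact: frame_orthogonal.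
pose y := x1 *m Q0^T.
have hy : y 0 0 ^+ 2 + y 0 1 ^+ 2 + y 0 2 ^+ 2 = 1.
  have : sphere2 y.
    apply/sphere2E; rewrite /y [(x1 *m _)^T]trmx_mul trmxK mulmxA.
    rewrite -(mulmxA x1) (mulmx1C hQ0) mulmx1; exact/sphere2E.
  rewrite /sphere2 /= !big_ord_recl big_ord0 addr0 addrA => <-.
  by congr (_ + y _ _ ^+ 2 + y _ _ ^+ 2); apply: val_inj.
have -> : x1 = y *m Q0 by rewrite /y -mulmxA (mulmx1C hQ0) mulmx1.
move: y hy => y hy.
suff [delta [alpha [e0 e1 e2]]] : exists delta alpha, [/\ y 0 0 = cos delta,
    y 0 1 = sin delta * cos alpha & y 0 2 = sin delta * sin alpha].
  exists (roll alpha *m Q0), delta; split.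
  - by apply: mulmx_orthogonal => //; exact: roll_orthogonal.
  - rewrite spherical_frame !mulmxA; congr (_ *m _ *m _).
    rewrite equatorE cos0 sin0; apply/rowP; elim/ord3P;
      rewrite !mxE !big_ord_recl big_ord0 !mxE /=; ring.
  rewrite mulmxA; have -> : equator delta *m roll alpha = y.
    rewrite equatorE; apply/rowP; elim/ord3P;
      rewrite ?e0 ?e1 ?e2 !mxE !big_ord_recl big_ord0 !mxE /=; ring.
  by [].
have [|delta [c s]] := @unit_circle (y 0 0) (Num.sqrt (y 0 1 ^+ 2 + y 0 2 ^+ 2)).
  by rewrite sqr_sqrtr ?addr_ge0 ?sqr_ge0 // addrA.
have s2 : sin delta ^+ 2 = y 0 1 ^+ 2 + y 0 2 ^+ 2.
  by rewrite -s sqr_sqrtr ?addr_ge0 ?sqr_ge0.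
(* If [sin delta = 0], the points are equal or antipodal and any great circle through [x0] will do,
   here the one with [alpha = 0]. *)
exists delta; have [sd|sd] := eqVneq (sin delta) 0.
  move: s2; rewrite sd expr0n /= => /esym/eqP; rewrite paddr_eq0 ?sqr_ge0 //.
  rewrite !sqrf_eq0 => /andP[/eqP y1 /eqP y2].
  by exists 0; rewrite y1 y2 !mul0r.
have [|alpha [ca sa]] := @unit_circle (y 0 1 / sin delta) (y 0 2 / sin delta).
  by rewrite !expr_div_n -mulrDl -s2 divff // expf_neq0.
by exists alpha; rewrite -ca -sa; split => //; rewrite mulrC divfK.
Qed.

End GreatCircles.

(** * Inner Schwarzschild spacetime *)

Section InnerSchwarzschild.
Context {R : realType}.
Implicit Types (m W mu z : R).

(* With respect to [r], at [theta = pi / 2]. *)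
Definition coefficient_derivative m (r : R) : seq R :=
  [:: - (2 * m / r ^+ 2) / (1 - 2 * m / r) ^+ 2; - (2 * m / r ^+ 2); 2 * r; 2 * r].

Definition diagonal_coefficients m (u : 'rV[R]_4) : 'rV[R]_4 :=
  let r := u 0 0 in \row_k [:: (1 - 2 * m / r)^-1; - (1 - 2 * m / r);
                      r ^+ 2; r ^+ 2 * sin (u 0 2) ^+ 2]`_k.

Lemma ord4P (P : 'I_4 -> Prop) : P 0 -> P 1 -> P 2 -> P 3 -> forall i, P i.
Proof.
move=> P0 P1 P2 P3 [[|[|[|[|//]]]] h].
- by move: P0; congr (P _); apply: val_inj.
- by move: P1; congr (P _); apply: val_inj.
- by move: P2; congr (P _); apply: val_inj.
- by move: P3; congr (P _); apply: val_inj.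
Qed.

Lemma is_derive_lapse m (a r : R) : r != 0 ->
  is_derive (0 : R) 1 (fun h => 1 - 2 * m / (h * a + r)) (2 * m / r ^+ 2 * a).
Proof.
move=> r0; have dr : is_derive (0 : R) 1 (fun h => h * a + r) a.
  by apply: is_derive_eq; rewrite /GRing.scale /=; ring.
have r0' : 0 * a + r != 0 by rewrite mul0r add0r.
have := @is_deriveV R (fun h => h * a + r) 0 a 1 r0' dr; rewrite mul0r add0r => dV.
by apply: is_derive_eq; rewrite /GRing.scale /=; ring.
Qed.

Lemma is_derive_lapseV m (a r : R) : r != 0 -> 1 - 2 * m / r != 0 ->
  is_derive (0 : R) 1 (fun h => (1 - 2 * m / (h * a + r))^-1)
    (- (1 - 2 * m / r) ^- 2 * (2 * m / r ^+ 2 * a)).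
Proof.
move=> r0 F0; have dF := is_derive_lapse m a r0.
have F0' : 1 - 2 * m / (0 * a + r) != 0 by rewrite mul0r add0r.
have := @is_deriveV R (fun h => 1 - 2 * m / (h * a + r)) 0 _ 1 F0' dF.
by rewrite mul0r add0r.
Qed.

(** Only derivatives in [r] survive: that of [sin theta ^ 2] in [theta] vanishes on the equator. *)
Lemma partial_diagonal_coefficients m (x : 'rV[R]_4) i j :
  x 0 0 != 0 -> 1 - 2 * m / x 0 0 != 0 -> x 0 2 = pi / 2 ->
  partial i (fun y => diagonal_coefficients m y 0 j) x =
  (0 == i)%:R * (coefficient_derivative m (x 0 0))`_j.
Proof.
move=> x0 F0 x2; apply: derive_line.
set a : R := (0 == i)%:R; set b : R := (2 == i)%:R.
set r := x 0 0 in x0 F0 *.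
have -> : (fun h : R => diagonal_coefficients m (h *: delta_mx 0 i + x) 0 j) =
    (fun h => [:: (1 - 2 * m / (h * a + r))^-1; - (1 - 2 * m / (h * a + r));
       (h * a + r) ^+ 2; (h * a + r) ^+ 2 * sin (h * b + pi / 2) ^+ 2]`_j).
  by apply/funext => h; rewrite !mxE /= x2.
have dr : is_derive (0 : R) 1 (fun h => h * a + r) a.
  by apply: is_derive_eq; rewrite /GRing.scale /=; ring.
have dF := is_derive_lapse m a x0.
have dFV := is_derive_lapseV a x0 F0.
move: j; elim/ord4P => /=.
- by apply: is_derive_eq; ring.
- by apply: is_derive_eq; ring.
- by apply: is_derive_eq; rewrite /GRing.scale /=; ring.
- apply: is_derive_eq; rewrite /GRing.scale /= !mul0r !add0r sin_pihalf cos_pihalf.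
  ring.
Qed.

(** The hypotheses left are the components in [r], [s] and [phi]. The component in [theta] holds by
    itself on the equator. *)
Lemma equatorial_geodesic_equation m (u u1 : R -> 'rV[R]_4) (u2 : 'rV[R]_4) (t : R) :
  let r := u t 0 0 in let F := 1 - 2 * m / r in
  r != 0 -> F != 0 ->
  (forall t, u t 0 2 = pi / 2) -> (forall t, u1 t 0 2 = 0) -> u2 0 2 = 0 ->
  (\forall s \near t, forall k, is_derive (s : R) 1 (fun s => u s 0 k) (u1 s 0 k)) ->
  (forall k, is_derive t 1 (fun s => u1 s 0 k) (u2 0 k)) ->
  u2 0 0 - m / (r ^+ 2 * F) * u1 t 0 0 ^+ 2 + F * (m / r ^+ 2) * u1 t 0 1 ^+ 2
    - F * r * u1 t 0 3 ^+ 2 = 0 ->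
  u2 0 1 + 2 * m / (r ^+ 2 * F) * u1 t 0 0 * u1 t 0 1 = 0 ->
  u2 0 3 + 2 / r * u1 t 0 0 * u1 t 0 3 = 0 ->
  geodesic_equation (inner_schwarzschild_metric m) u t.
Proof.
move=> r F r0 F0 ut2 u1t2 u22 du du1 e0 e1 e3.
apply: (@geodesic_equation_diag R 4 (diagonal_coefficients m) u u1 (u2 0)
  (fun i j => (0 == i)%:R * (coefficient_derivative m r)`_j) t) => //.
- elim/ord4P; rewrite !mxE /=.
  + by rewrite invr_eq0.
  + by rewrite oppr_eq0.
  + by rewrite expf_neq0.
  + by rewrite ut2 sin_pihalf expr1n mulr1 expf_neq0.
- by move=> i j; rewrite partial_diagonal_coefficients.
have S k : \sum_(i < 4) (0 == i)%:R * (coefficient_derivative m r)`_k * u1 t 0 i =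
    (coefficient_derivative m r)`_k * u1 t 0 0.
  rewrite (bigD1 0) //= big1 => [|i i0]; first by rewrite mul1r addr0.
  by rewrite eq_sym (negPf i0) !mul0r.
have S' (k : 'I_4) :
    \sum_(i < 4) (0 == k)%:R * (coefficient_derivative m r)`_i * u1 t 0 i ^+ 2 =
    (0 == k)%:R * \sum_(i < 4) (coefficient_derivative m r)`_i * u1 t 0 i ^+ 2.
  by rewrite mulr_sumr; apply: eq_bigr => i _; rewrite mulrA.
have S4 : \sum_(i < 4) (coefficient_derivative m r)`_i * u1 t 0 i ^+ 2 =
   - (2 * m / (r ^+ 2 * F ^+ 2)) * u1 t 0 0 ^+ 2
    - (2 * m / r ^+ 2) * u1 t 0 1 ^+ 2 + 2 * r * u1 t 0 3 ^+ 2.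
  rewrite !big_ord_recl big_ord0 /=.
  have -> : lift ord0 ord0 = 1 :> 'I_4 by apply: val_inj.
  have -> : lift ord0 (lift ord0 ord0) = 2 :> 'I_4 by apply: val_inj.
  have -> : lift ord0 (lift ord0 (lift ord0 ord0)) = 3 :> 'I_4 by apply: val_inj.
  rewrite u1t2 -/F; field; by rewrite F0 r0.
move=> k; rewrite S S' S4; move: k; elim/ord4P; rewrite mxE /= -/r -/F.
- rewrite -[RHS]e0; field; by rewrite ?r0 ?F0.
- rewrite -[RHS]e1; field; by rewrite ?r0 ?F0.
- rewrite u22 u1t2; field; by rewrite ?r0 ?F0.
- rewrite -[RHS]e3 ut2 sin_pihalf expr1n mulr1; field; by rewrite ?r0 ?F0.
Qed.
End InnerSchwarzschild.

(** * Orbits as solutions of the geodesic equation *)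

Section OrbitGeodesic.
Context {R : realType}.
Variables (m W mu S v a b : R) (z : R -> R).
Hypotheses (m0 : 0 < m) (W0 : 0 < W) (mu3 : 0 < mu < 3).
Hypothesis S2 : S ^+ 2 = (1 - mu) * (2 + (2 - mu) * W).

Let N (x : R) := inv_radius W x.
Let D (x : R) := Num.sqrt (radicand W mu x).
Let D' (x : R) : R :=
  (x * (2 + W * (3 - mu + x ^+ 2)) + (mu + x ^+ 2) * (W * x)) / D x.

Hypothesis z' : forall t : R, a < t < b ->
  is_derive t 1 z (v * (N (z t) ^+ 2 * D (z t))).

Let D_gt0 x : 0 < D x. Proof. by rewrite sqrtr_gt0 radicand_gt0. Qed.

Let dN (x : R) : is_derive x 1 N (2 * W * x).
Proof. apply: is_derive_eq; rewrite /GRing.scale /=; ring. Qed.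

Let dD (x : R) : is_derive x 1 D (D' x).
Proof.
have r0 : 0 < radicand W mu x by exact: radicand_gt0.
have dr : is_derive x 1 (radicand W mu)
    (2 * (x * (2 + W * (3 - mu + x ^+ 2)) + (mu + x ^+ 2) * (W * x))).
  apply: is_derive_eq; rewrite /GRing.scale /=; ring.
have ds := is_derive1_sqrt r0.
have := is_derive1_comp ds dr; rewrite -/D => d; apply: is_derive_eq.
rewrite /D' /D; field; rewrite gt_eqF //; exact: D_gt0.
Qed.

(** The given rates are the conservation laws: with [r = 2 m / N], they make [r ^ 2 phi'] equal to
    [8 m ^ 2 v] and [(1 - 2 m / r) s'] equal to [- 4 m W v S]. Only the square of [S] is prescribed,
    so both directions of [s] are allowed. *)
Lemma orbit_geodesic_equation (phi s : R -> R) :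
  (forall t : R, a < t < b -> is_derive t 1 phi (2 * v * N (z t) ^+ 2)) ->
  (forall t : R, a < t < b -> is_derive t 1 s (4 * m * v * S / (1 + z t ^+ 2))) ->
  forall t, a < t < b -> geodesic_equation (inner_schwarzschild_metric m)
    (fun t => \row_k [:: 2 * m / N (z t); s t; pi / 2; phi t]`_k) t.
Proof.
move=> phi' s' t tab.
have N_gt0 x : 0 < N x by rewrite (lt_trans ltr01) // inv_radius_gt1.
have Y_gt0 (x : R) : 0 < 1 + x ^+ 2 by rewrite ltr_pwDl // sqr_ge0.
have [n0 y0 w0 d0 m00] :
    [/\ N (z t) != 0, 1 + z t ^+ 2 != 0, W != 0, D (z t) != 0 & m != 0].
  by split; rewrite gt_eqF.
have NE : N (z t) = 1 + W * (1 + z t ^+ 2) by [].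
have D2 : D (z t) ^+ 2 = radicand W mu (z t) by rewrite sqr_sqrtr ?ltW // radicand_gt0.
pose dz (x : R) := v * (N (z x) ^+ 2 * D (z x)).
have dNz (x : R) : a < x < b -> is_derive x 1 (fun t => N (z t)) (2 * W * z x * dz x).
  by move=> h; exact: (is_derive1_comp (dN (z x)) (z' h)).
have dDz (x : R) : a < x < b -> is_derive x 1 (fun t => D (z t)) (D' (z x) * dz x).
  by move=> h; exact: (is_derive1_comp (dD (z x)) (z' h)).
pose u1 (x : R) : 'rV[R]_4 := \row_k [:: - (4 * m * W * v * (z x * D (z x)));
  4 * m * v * S / (1 + z x ^+ 2); 0; 2 * v * N (z x) ^+ 2]`_k.
pose u2 : 'rV[R]_4 := \row_k
  [:: - (4 * m * W * v * (dz t * D (z t) + z t * (D' (z t) * dz t)));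
     - (4 * m * v * S * (2 * z t * dz t) / (1 + z t ^+ 2) ^+ 2); 0;
     4 * v * N (z t) * (2 * W * z t * dz t)]`_k.
have F0 : 1 - 2 * m / (2 * m / N (z t)) = - (W * (1 + z t ^+ 2)).
  have -> : 2 * m / (2 * m / N (z t)) = N (z t) by field; rewrite n0.
  by rewrite NE; ring.
apply: (@equatorial_geodesic_equation R m _ u1 u2 t).
- by rewrite mxE /= mulf_neq0 ?invr_eq0 // mulf_neq0.
- by rewrite mxE /= F0 oppr_eq0 mulf_neq0.
- by move=> t'; rewrite mxE.
- by move=> t'; rewrite mxE.
- by rewrite mxE.
- have : \forall t' \near t, a < t' < b.
    have : \forall t' \near t, t' \in `]a, b[%R by apply: near_in_itvoo; rewrite in_itv.
    by apply: filterS => t'; rewrite in_itv.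
  apply: filterS => t' h; elim/ord4P; rewrite /u1 mxE /=.
  + rewrite (_ : (fun _ => _) = (fun t => 2 * m / N (z t))); last first.
      by apply/funext => x; rewrite mxE.
    have := dNz _ h => dn.
    have := @is_deriveV R (fun t => N (z t)) t' _ 1 (lt0r_neq0 (N_gt0 _)) dn => dV.
    apply: is_derive_eq; rewrite /GRing.scale /= /dz; field.
    by rewrite gt_eqF.
  + rewrite (_ : (fun _ => _) = s); first exact: s'.
    by apply/funext => x; rewrite mxE.
  + rewrite (_ : (fun _ => _) = cst (pi / 2)); first exact: is_derive_cst.
    by apply/funext => x; rewrite mxE.
  + rewrite (_ : (fun _ => _) = phi); first exact: phi'.
    by apply/funext => x; rewrite mxE.
- have := z' tab; have := dNz _ tab; have := dDz _ tab => d1 d2 d3.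
  elim/ord4P; rewrite /u2 mxE /=.
  + rewrite (_ : (fun _ => _) = (fun t => - (4 * m * W * v * (z t * D (z t))))); last first.
      by apply/funext => x; rewrite mxE.
    apply: is_derive_eq; rewrite /GRing.scale /= /dz; ring.
  + rewrite (_ : (fun _ => _) = (fun t => 4 * m * v * S * (1 + z t ^+ 2)^-1)); last first.
      by apply/funext => x; rewrite mxE.
    have dY : is_derive t 1 (fun t => 1 + z t ^+ 2) (2 * z t * dz t).
      apply: is_derive_eq; rewrite /GRing.scale /= /dz; ring.
    have := @is_deriveV R (fun t => 1 + z t ^+ 2) t _ 1 y0 dY => dV.
    apply: is_derive_eq; rewrite /GRing.scale /= /dz; field.
    by rewrite y0.
  + rewrite (_ : (fun _ => _) = cst 0); first exact: is_derive_cst.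
    by apply/funext => x; rewrite mxE.
  + rewrite (_ : (fun _ => _) = (fun t => 2 * v * N (z t) ^+ 2)); last first.
      by apply/funext => x; rewrite mxE.
    apply: is_derive_eq; rewrite /GRing.scale /= /dz; ring.
- rewrite !mxE /= F0 /dz /D'.
  (* The radial equation is a combination of the relations defining D, S and N. *)
  transitivity (4 * m * W * v ^+ 2 * N (z t) ^+ 2 / (1 + z t ^+ 2) *
    (z t ^+ 2 * (D (z t) ^+ 2 - radicand W mu (z t)) -
     (S ^+ 2 - (1 - mu) * (2 + (2 - mu) * W)) -
     (1 + z t ^+ 2) * (D (z t) ^+ 2 - radicand W mu (z t)) +
     2 * (1 + z t ^+ 2) ^+ 2 * (N (z t) - (1 + W * (1 + z t ^+ 2))))); last first.
    by rewrite D2 S2 -NE !subrr; ring.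
  rewrite /radicand; field; by rewrite ?n0 ?y0 ?w0 ?d0 ?m00.
- rewrite !mxE /= F0 /dz; field; by rewrite ?n0 ?y0 ?w0 ?d0 ?m00.
- rewrite !mxE /= /dz; field; by rewrite ?n0 ?y0 ?w0 ?d0 ?m00.
Qed.

End OrbitGeodesic.

(** * Geodesic connectedness of the spacetime *)

Section Connected.
Context {R : realType}.

(** A curve that winds leaves every single chart. Around each [t] the chart is rotated by [phi t],
    so that the angle in it stays near 0, away from the cut at [pi]. *)
Lemma equatorial_geodesic (m : R) (Q : 'M[R]_3) (r s phi : R -> R) (a b : R) :
  Q *m Q^T = 1%:M ->
  (forall t, a < t < b -> 0 < r t < 2 * m) ->
  (forall t, a < t < b -> {for t, continuous phi}) ->
  (forall (c t : R), a < t < b -> geodesic_equation (inner_schwarzschild_metric m)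
    (fun t => \row_k [:: r t; s t; pi / 2; phi t - c]`_k) t) ->
  geodesic (inner_schwarzschild_atlas m) `]a, b[%classic
    (fun t => (r t, s t, equator (phi t) *m Q)).
Proof.
move=> hQ hr cphi geo t; rewrite /= in_itv /= => tab.
have pi0 := pi_gt0 R.
exists (inner_schwarzschild_chart m (frame (pi / 2) (phi t) *m Q)).
  by exists (frame (pi / 2) (phi t) *m Q) => //; apply: mulmx_orthogonal => //;
    exact: frame_orthogonal.
exists (fun x => \row_k [:: r x; s x; pi / 2; phi x - phi t]`_k).
have nab : \forall x \near t, x \in `]a, b[%R by apply: near_in_itvoo; rewrite in_itv.
have nphi : \forall x \near t, `|phi t - phi x| < pi.
  exact: (cvgr_dist_lt _ _ (cphi t tab) _ pi0).
near=> x.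
have xab : a < x < b by have : x \in `]a, b[%R by [near: x]; rewrite in_itv.
split; last exact: geo.
- rewrite /= !mxE /= hr // ltr_pdivrMr // ltr_pMr // ltr1n divr_gt0 //=; split => //.
  have : `|phi t - phi x| < pi by near: x.
  by rewrite distrC ltr_norml.
- rewrite /= !mxE /= mulmxA -/(equator _) -equatorD.
  by rewrite subrK.
Unshelve. all: end_near. Qed.

Lemma inner_schwarzschild_connected (m : R) : 0 < m ->
  geodesically_connected (inner_schwarzschild m) (inner_schwarzschild_atlas m).
Proof.
move=> m0 [[r0 s0] x0] [[r1 s1] x1] [/= r0m hx0] [/= r1m hx1].
have [Q [d [hQ -> ->]]] := great_circle hx0 hx1.
pose X0 := 2 * m / r0 - 1; pose X1 := 2 * m / r1 - 1.
have [r00 r10] : 0 < r0 /\ 0 < r1 by lra.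
have X0p : 0 < X0 by rewrite subr_gt0 ltr_pdivlMr // mul1r; lra.
have X1p : 0 < X1 by rewrite subr_gt0 ltr_pdivlMr // mul1r; lra.
have [W [mu [k [WX0 WX1 mu1 angleE timeE]]]] :=
  exists_orbit d m0 X0p X1p (normr_ge0 (s1 - s0)).
have W0 : 0 < W by lra.
have mu3 : 0 < mu < 3 by lra.
have p0 : 0 < endpoint X0 W by exact: endpoint_gt0.
have p1 : 0 < endpoint X1 W by apply: endpoint_gt0; rewrite W0.
pose D (x : R) := Num.sqrt (radicand W mu x).
have D0 x : 0 < D x by rewrite sqrtr_gt0 radicand_gt0.
have N0 x : 0 < inv_radius W x by rewrite (lt_trans ltr01) // inv_radius_gt1.
(* The unknown is [z] as a function of the affine parameter; [phi] and [s] are then antiderivatives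
   evaluated at [z t]. *)
have [||| v [a [b [z [v0 a0 b1 [z0 z1] z']]]]] :=
  @autonomous_ode R (fun x => inv_radius W x ^+ 2 * D x)
    (- endpoint X0 W) (endpoint X1 W).
- move=> x; apply: cvgM.
    have dN : is_derive x 1 (fun x => inv_radius W x ^+ 2)
        (2 * inv_radius W x * (2 * W * x)).
      apply: is_derive_eq; rewrite /GRing.scale /= /inv_radius; ring.
    exact: is_derive1_continuous dN.
  exact: (regular_rate_continuous (@regular_sqrt_radicand R) W0 mu3).
- by move=> x; rewrite mulr_gt0 // exprn_gt0.
- by lra.
(* [exists_orbit] realises only nonnegative increments of [s]; the reflection of [s] supplies the
   sign. *)
have [sg [sg2 sgE]] : exists sg : R, sg ^+ 2 = 1 /\ s1 - s0 = sg * `|s1 - s0|.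
  have [h|h] := leP 0 (s1 - s0).
    by exists 1; rewrite expr1n mul1r ger0_norm.
  by exists (-1); rewrite sqrrN expr1n ltr0_norm // mulN1r opprK.
pose A := antider (angle_rate W mu); pose B := antider (time_rate m W mu).
pose phi t := A (z t) - A (- endpoint X0 W).
pose s t := s0 + sg * (B (z t) - B (- endpoint X0 W)).
pose S := sg * Num.sqrt ((1 - mu) * (2 + (2 - mu) * W)).
have S2 : S ^+ 2 = (1 - mu) * (2 + (2 - mu) * W).
  rewrite exprMn sg2 mul1r sqr_sqrtr // mulr_ge0 //; first by lra.
  by rewrite addr_ge0 // mulr_ge0 //; lra.
have phi' (t : R) : a < t < b -> is_derive t 1 phi (2 * v * inv_radius W (z t) ^+ 2).
  move=> tab; have := is_derive1_comp (antider_angle_rate W0 mu3 (z t)) (z' t tab) => dA.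
  apply: is_derive_eq; rewrite /angle_rate -/(D _); field.
  by rewrite gt_eqF.
have s' (t : R) : a < t < b -> is_derive t 1 s (4 * m * v * S / (1 + z t ^+ 2)).
  move=> tab; have := is_derive1_comp (antider_time_rate m W0 mu3 (z t)) (z' t tab) => dB.
  apply: is_derive_eq; rewrite /time_rate -/(D _) /S /GRing.scale /=; field.
  by rewrite !gt_eqF // ltr_pwDl // sqr_ge0.
have endE (r X x : R) : 0 < r -> X = 2 * m / r - 1 -> W * (1 + x ^+ 2) = X ->
    2 * m / inv_radius W x = r.
  move=> hr -> E; rewrite /inv_radius E addrC subrK.
  by field; rewrite !gt_eqF.
exists a, b, (fun t => (2 * m / inv_radius W (z t), s t, equator (phi t) *m Q)).
split => //.
- apply: equatorial_geodesic => //.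
  + move=> t _; rewrite divr_gt0 ?mulr_gt0 //= ltr_pdivrMr // ltr_pMr ?mulr_gt0 //.
    exact: inv_radius_gt1.
  + by move=> t /phi'; exact: is_derive1_continuous.
  + move=> c t; apply: (@orbit_geodesic_equation R m W mu S v) => // t' t'ab.
    have := phi' t' t'ab => dphi.
    by apply: is_derive_eq; rewrite subr0.
- rewrite z0 (endE r0 X0) ?sqrrN ?sqr_endpoint //.
  by rewrite /s /phi z0 !subrr mulr0 addr0.
- rewrite z1 (endE r1 X1) ?sqr_endpoint ?W0 //.
  rewrite /s /phi z1 -[A _ - _]/(increment angle_rate X0 X1 W mu) angleE equatorD2pin.
  by rewrite -[B _ - _]/(increment (time_rate m) X0 X1 W mu) timeE -sgE subrKC.
Qed.

End Connected.

(** * The surface *)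

Section Surface.
Context {R : realType}.

(** A positive value of [f] would force a positive slope before it and a negative one after it,
    against the monotonicity of [f1]. *)
Lemma convex_le0 (f f1 f2 : R -> R) : f 0 = 0 -> f 1 = 0 ->
  (forall t : R, 0 <= t <= 1 -> is_derive t 1 f (f1 t)) ->
  (forall t : R, 0 <= t <= 1 -> is_derive t 1 f1 (f2 t)) ->
  (forall t, 0 <= t <= 1 -> 0 <= f2 t) -> forall t, 0 <= t <= 1 -> f t <= 0.
Proof.
move=> f0 f1_0 d1 d2 f2p t t01.
have [c c01 ec] : exists2 c, 0 <= c <= t & f t - f 0 = f1 c * (t - 0).
  by apply: mean_value; [lra|move=> x xt; apply: d1; lra].
have [e e01 ee] : exists2 c, t <= c <= 1 & f 1 - f t = f1 c * (1 - t).
  by apply: mean_value; [lra|move=> x xt; apply: d1; lra].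
have ce : f1 c <= f1 e.
  apply: (derive_ge0_le (df := f2)); first by lra.
    by move=> x xt; apply: d2; lra.
  by move=> x xt; apply: f2p; lra.
rewrite leNgt; apply/negP => ft.
have [h|h] := leP (f1 c) 0.
  by have : f1 c * (t - 0) <= 0 by [rewrite mulr_le0_ge0 //; lra]; lra.
by have : 0 <= f1 e * (1 - t) by [rewrite mulr_ge0 //; lra]; lra.
Qed.

(* [E] is the conserved energy and [K] the constant value of the metric on the
   velocity. *)
Lemma surface_time_bound (m E K : R) (r r1 s : R -> R) : 0 < m ->
  (forall t, 0 <= t <= 1 -> 0 < r t < 2 * m) -> r 0 = m -> r 1 = m ->
  (forall t : R, 0 <= t <= 1 -> is_derive t 1 r (r1 t)) ->
  (forall t : R, 0 <= t <= 1 -> is_derive t 1 r1 (K * m / r t ^+ 2)) ->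
  (forall t : R, 0 <= t <= 1 -> is_derive t 1 s (E * r t / (2 * m - r t))) ->
  (forall t, 0 <= t <= 1 -> r1 t ^+ 2 = E ^+ 2 - K * (2 * m / r t - 1)) ->
  s 1 - s 0 <> 10 * m.
Proof.
move=> m0 rm r0 r1m dr dr1 ds energy sE.
have I0 : (0 : R) <= (0 : R) <= 1 by lra.
have I1 : (0 : R) <= (1 : R) <= 1 by lra.
have G0 t : 0 <= t <= 1 -> 0 < 2 * m / r t - 1.
  by move=> /rm /andP[h1 h2]; rewrite subr_gt0 ltr_pdivlMr // mul1r.
have E0 : 0 < E.
  have [c c01 e] := mean_value ler01 ds.
  have /andP[h1 h2] := rm _ c01.
  have : 0 < E * r c / (2 * m - r c).
    by move: e; rewrite sE subr0 mulr1 => <-; rewrite mulr_gt0.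
  by rewrite pmulr_lgt0 ?pmulr_lgt0 // invr_gt0; lra.
(* By Rolle's theorem [r1] vanishes somewhere, and there the energy relation makes [K] positive: the
   geodesic is spacelike. *)
have K0 : 0 < K.
  have [c c01 e] := mean_value ler01 dr.
  have r1c : r1 c = 0 by move: e; rewrite r0 r1m; lra.
  have : K * (2 * m / r c - 1) = E ^+ 2.
    by have := energy _ c01; rewrite r1c expr0n /=; lra.
  move=> e2; have : 0 < K * (2 * m / r c - 1) by rewrite e2 exprn_gt0.
  by rewrite pmulr_lgt0 // G0.
have rle t : 0 <= t <= 1 -> r t <= m.
  move=> t01; rewrite -subr_le0.
  apply: (@convex_le0 (fun t => r t - m) r1 (fun t => K * m / r t ^+ 2)) => //.
  - by rewrite r0 subrr.
  - by rewrite r1m subrr.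
  - move=> x x01; have := dr x x01 => d; rewrite -[r1 x]subr0; apply: is_deriveB.
  - by move=> x x01; rewrite divr_ge0 ?sqr_ge0 // mulr_ge0 // ltW.
(* As [r <= m], the second derivative of [r] is at least [K / m], so [r - m] lies below the parabola
   [K / (2 m) (t ^ 2 - t)]. At [t = 1/2] the positivity of [r] bounds [K]. *)
have K8 : K < 8 * m ^+ 2.
  have h2 : (0 : R) <= (2^-1 : R) <= 1 by lra.
  have /andP[rh _] := rm _ h2.
  have : r 2^-1 - m - K / (2 * m) * (2^-1 ^+ 2 - 2^-1) <= 0.
    apply: (@convex_le0 (fun t => r t - m - K / (2 * m) * (t ^+ 2 - t))
      (fun t => r1 t - K / (2 * m) * (2 * t - 1)) (fun t => K * m / r t ^+ 2 - K / m)) => //.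
    - by rewrite r0; ring.
    - by rewrite r1m; ring.
    - move=> x x01; have := dr x x01 => d; apply: is_derive_eq.
      rewrite /GRing.scale /=; ring.
    - move=> x x01; have := dr1 x x01 => d; apply: is_derive_eq.
      by rewrite /GRing.scale /=; field; rewrite ?gt_eqF //; case/andP: (rm _ x01).
    - move=> x x01; have /andP[rx _] := rm _ x01.
      have -> : K * m / r x ^+ 2 - K / m = K * (m ^+ 2 - r x ^+ 2) / (m * r x ^+ 2).
        by field; rewrite !gt_eqF.
      apply: divr_ge0; last by rewrite mulr_ge0 ?sqr_ge0 // ltW.
      apply: mulr_ge0; first exact: ltW.
      by rewrite subr_ge0 ler_sqr ?nnegrE ?(ltW rx) ?(ltW m0) // rle.
  have -> : r 2^-1 - m - K / (2 * m) * (2^-1 ^+ 2 - 2^-1) = r 2^-1 - m + K / (8 * m).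
    by field; rewrite gt_eqF.
  move=> h; have : K / (8 * m) < m by lra.
  by rewrite ltr_pdivrMr ?mulr_gt0 // expr2; lra.
have KE : K <= E ^+ 2.
  have := energy _ I0; rewrite r0 mulfK ?gt_eqF //.
  by have := sqr_ge0 (r1 0); lra.
have r1E t : 0 <= t <= 1 -> `|r1 t| <= E.
  move=> t01; rewrite -ler_sqr ?nnegrE ?(ltW E0) // real_normK ?num_real // energy //.
  by rewrite gerBl mulr_ge0 ?(ltW K0) // ltW // G0.
(* Subtracting [r ^ 2 r1] and [3 K m t] from [2 m E s] leaves the derivative [- dg], nonpositive
   because [m / (2 m - r) <= 1]. This bounds the increment of [s] by boundary terms. *)
pose g t := 2 * m * E * s t - r t ^+ 2 * r1 t - 3 * K * m * t.
pose dg t := 2 * r t * (K + E ^+ 2 * (1 - m / (2 * m - r t))).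
have g' (t : R) : 0 <= t <= 1 -> is_derive t 1 (fun t => - g t) (dg t).
  move=> t01; have := dr t t01; have := dr1 t t01; have := ds t t01 => d1 d2 d3.
  rewrite /g; apply: is_derive_eq; rewrite /GRing.scale /=.
  have /andP[rt rt2] := rm _ t01.
  transitivity (dg t + 2 * r t * (r1 t ^+ 2 - (E ^+ 2 - K * (2 * m / r t - 1)))).
    rewrite /dg; field; rewrite ?gt_eqF //; lra.
  by rewrite energy // subrr mulr0 addr0.
have : g 1 <= g 0.
  rewrite -lerN2; apply: (derive_ge0_le ler01 g').
  move=> t t01; have /andP[rt rt2] := rm _ t01.
  apply: mulr_ge0; first by lra.
  rewrite addr_ge0 ?(ltW K0) // mulr_ge0 ?sqr_ge0 // subr_ge0 ler_pdivrMr; last by lra.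
  by have := rle _ t01; lra.
rewrite /g r0 r1m mulr1 mulr0 subr0.
have := r1E _ I0; have := r1E _ I1; rewrite !ler_norml => /andP[h1 h2] /andP[h3 h4].
have b1 : m ^+ 2 * r1 1 <= m ^+ 2 * E by rewrite ler_pM2l ?exprn_gt0.
have b0 : m ^+ 2 * - E <= m ^+ 2 * r1 0 by rewrite ler_pM2l ?exprn_gt0.
move=> h.
(* With an increment of [10 m] this yields [6 m E <= K <= E ^ 2], hence [6 m <= E] and
   [36 m ^ 2 <= K], against [K < 8 m ^ 2]. *)
have h5 : 2 * m * E * (10 * m) <= 2 * (m ^+ 2 * E) + 3 * K * m by rewrite -sE; lra.
have h6 : m * (6 * m * E) <= m * K by rewrite expr2 in h5; lra.
rewrite ler_pM2l // in h6.
have h7 : 6 * m <= E.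
  by rewrite -(ler_pM2r E0) -expr2 (le_trans h6).
have h8 : 6 * m * (6 * m) <= 6 * m * E by rewrite ler_pM2l // mulr_gt0.
by have := exprn_gt0 2 m0; rewrite expr2 in K8 *; lra.
Qed.

(** * The geodesic equation on the surface and its conserved quantities *)

Lemma geodesic_equation_near_eq n (g : 'rV[R]_n -> 'M[R]_n)
    (u w : R -> 'rV[R]_n) (t : R) :
  (\forall s \near t, u s = w s) -> geodesic_equation g u t -> geodesic_equation g w t.
Proof.
move=> uw; rewrite /geodesic_equation /= => geo k.
have E0 j : \forall s \near t, u s 0 j = w s 0 j by apply: filterS uw => s ->.
have E1 j : \forall s \near t, derive1 (fun s => u s 0 j) s = derive1 (fun s => w s 0 j) s.
  have := near_join (E0 j); apply: filterS => s us.
  by rewrite !derive1E; apply: near_eq_derive.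
have [h1 h2 h3] := geo k; split.
- exact: (near_eq_derivable (E0 k) h1).
- exact: (near_eq_derivable (E1 k) h2).
have E2 : derive1 (derive1 (fun s => u s 0 k)) t = derive1 (derive1 (fun s => w s 0 k)) t.
  by rewrite derive1E [RHS]derive1E; apply: near_eq_derive; exact: E1.
rewrite -E2 -(nbhs_singleton uw).
under eq_bigr do under eq_bigr do rewrite -!(nbhs_singleton (E1 _)).
exact: h3.
Qed.

Definition surface_coefficients (m : R) (u : 'rV[R]_2) : 'rV[R]_2 :=
  let r := u 0 0 in \row_k [:: (1 - 2 * m / r)^-1; - (1 - 2 * m / r)]`_k.

Lemma ord2P (P : 'I_2 -> Prop) : P 0 -> P 1 -> forall i, P i.
Proof.
move=> P0 P1 [[|[|//]] h].
- by move: P0; congr (P _); apply: val_inj.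
- by move: P1; congr (P _); apply: val_inj.
Qed.

Lemma partial_surface_coefficients m (x : 'rV[R]_2) i j :
  x 0 0 != 0 -> 1 - 2 * m / x 0 0 != 0 ->
  partial i (fun y => surface_coefficients m y 0 j) x =
  (0 == i)%:R * (coefficient_derivative m (x 0 0))`_j.
Proof.
move=> x0 F0; apply: derive_line.
set a : R := (0 == i)%:R; set r := x 0 0 in x0 F0 *.
have -> : (fun h : R => surface_coefficients m (h *: delta_mx 0 i + x) 0 j) =
    (fun h => [:: (1 - 2 * m / (h * a + r))^-1; - (1 - 2 * m / (h * a + r))]`_j).
  by apply/funext => h; rewrite !mxE.
have dF := is_derive_lapse m a x0.
have dFV := is_derive_lapseV a x0 F0.
move: j; elim/ord2P => /=; apply: is_derive_eq; ring.
Qed.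

Lemma surface_geodesic_equation m (u : R -> 'rV[R]_2) (t : R) :
  let r (t : R) := u t 0 0 in let s (t : R) := u t 0 1 in let F := 1 - 2 * m / r t in
  r t != 0 -> F != 0 -> geodesic_equation (inner_surface_metric m) u t ->
  [/\ is_derive t 1 r (derive1 r t), is_derive t 1 s (derive1 s t),
    is_derive t 1 (derive1 r)
      (m / (r t ^+ 2 * F) * derive1 r t ^+ 2 - F * (m / r t ^+ 2) * derive1 s t ^+ 2) &
    is_derive t 1 (derive1 s) (- (2 * m / (r t ^+ 2 * F)) * derive1 r t * derive1 s t)].
Proof.
move=> r s F r0 F0; rewrite /geodesic_equation /= => geo.
have d0 (k : 'I_2) : surface_coefficients m (u t) 0 k != 0.
  by move: k; elim/ord2P; rewrite mxE /= ?invr_eq0 ?oppr_eq0.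
have S (k : 'I_2) (v : 'I_2 -> R) :
    \sum_(i < 2) partial i (fun y => surface_coefficients m y 0 k) (u t) * v i =
    (coefficient_derivative m (r t))`_k * v 0.
  rewrite (bigD1 0) //= big1 => [|i i0]; rewrite partial_surface_coefficients //.
    by rewrite eqxx mul1r addr0.
  by rewrite eq_sym (negPf i0) !mul0r.
have S' (k : 'I_2) (v : 'I_2 -> R) :
    \sum_(i < 2) partial k (fun y => surface_coefficients m y 0 i) (u t) * v i ^+ 2 =
    (0 == k)%:R * ((coefficient_derivative m (r t))`_0 * v 0 ^+ 2 +
      (coefficient_derivative m (r t))`_1 * v 1 ^+ 2).
  rewrite !big_ord_recl big_ord0 !partial_surface_coefficients //=.
  have -> : lift ord0 ord0 = 1 :> 'I_2 by apply: val_inj.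
  by rewrite addr0 mulrDr !mulrA.
have [[h1 h2 h3] [k1 k2 k3]] := (geo 0, geo 1).
split.
- by rewrite derive1E; exact: (derivableP h1).
- by rewrite derive1E; exact: (derivableP k1).
- apply: (DeriveDef h2); rewrite -derive1E; move: h3.
  rewrite (christoffel_diag_sum (d := surface_coefficients m) _ _ d0) S S' mxE /=.
  move=> /eqP; rewrite addr_eq0 => /eqP ->.
  rewrite -/r -/s -/(r t) -/F; field; by rewrite ?r0 ?F0.
- apply: (DeriveDef k2); rewrite -derive1E; move: k3.
  rewrite (christoffel_diag_sum (d := surface_coefficients m) _ _ d0) S S' mxE /=.
  move=> /eqP; rewrite addr_eq0 => /eqP ->.
  rewrite -/r -/s -/(r t) -/F; field; by rewrite ?r0 ?F0.
Qed.

Lemma inner_surface_not_connected (m : R) : 0 < m ->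
  ~ geodesically_connected (inner_surface m) (inner_surface_atlas m).
Proof.
move=> m0 conn.
pose p (s : R) : 'rV[R]_2 := \row_k [:: m; s]`_k.
have Mp s : inner_surface m (p s).
  by rewrite /inner_surface /= mxE /= m0 /=; lra.
have [a [b [u [a0 b1 geo u0 u1]]]] := conn _ _ (Mp 0) (Mp (10 * m)).
pose r (t : R) := u t 0 0; pose s (t : R) := u t 0 1.
pose F (t : R) := 1 - 2 * m / r t.
have geoE t : 0 <= t <= 1 ->
    0 < r t < 2 * m /\ geodesic_equation (inner_surface_metric m) u t.
  move=> t01; have tab : `]a, b[%classic t by rewrite /= in_itv /=; lra.
  have [_ -> [w /= wP]] := geo t tab.
  have [h1 h2 h3] := nbhs_singleton wP; split; first by rewrite /r h2.
  by apply: (geodesic_equation_near_eq _ h3); apply: filterS wP => x [_ -> _].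
have rm t : 0 <= t <= 1 -> 0 < r t < 2 * m by move=> /geoE[].
have F0 t : 0 <= t <= 1 -> F t < 0.
  by move=> /rm /andP[h1 h2]; rewrite subr_lt0 ltr_pdivlMr // mul1r.
have r_neq0 t : 0 <= t <= 1 -> r t != 0 by move=> /rm /andP[h _]; rewrite gt_eqF.
have F_neq0 t : 0 <= t <= 1 -> F t != 0 by move=> /F0 h; rewrite lt_eqF.
have geoD t (t01 : 0 <= t <= 1) :=
  surface_geodesic_equation (r_neq0 t t01) (F_neq0 t t01) (geoE t t01).2.
have dF (t : R) : 0 <= t <= 1 -> is_derive t 1 F (2 * m / r t ^+ 2 * derive1 r t).
  move=> t01; have [dr _ _ _] := geoD t t01.
  have := @is_deriveV R r t _ 1 (r_neq0 t t01) dr => dV.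
  apply: is_derive_eq; rewrite /GRing.scale /=; ring.
(* [E] is conserved because the metric does not depend on [s]; [K] is the value of the metric on the
   velocity. *)
pose E t := - (F t * derive1 s t).
pose K t := derive1 r t ^+ 2 / F t - F t * derive1 s t ^+ 2.
have dE (t : R) : 0 <= t <= 1 -> is_derive t 1 E 0.
  move=> t01; have [dr ds dr1 ds1] := geoD t t01; have := dF t t01 => dFt.
  apply: is_derive_eq; rewrite /GRing.scale /= -/(r t) -/(F t); field.
  by rewrite r_neq0 // F_neq0.
have dK (t : R) : 0 <= t <= 1 -> is_derive t 1 K 0.
  move=> t01; have [dr ds dr1 ds1] := geoD t t01; have := dF t t01 => dFt.
  have := @is_deriveV R F t _ 1 (F_neq0 t t01) dFt => dV.
  apply: is_derive_eq; rewrite /GRing.scale /= -/(r t) -/(F t); field.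
  by rewrite r_neq0 // F_neq0.
have E0 t : 0 <= t <= 1 -> E t = E 0.
  by move=> t01; apply: derive0_constant; [lra | move=> x xt; apply: dE; lra].
have K0 t : 0 <= t <= 1 -> K t = K 0.
  by move=> t01; apply: derive0_constant; [lra | move=> x xt; apply: dK; lra].
apply: (@surface_time_bound m (E 0) (K 0) r (derive1 r) s) => //.
- by rewrite /r u0 mxE.
- by rewrite /r u1 mxE.
- by move=> t /geoD[].
- move=> t t01; have [_ _ d _] := geoD t t01; apply: is_derive_eq.
  rewrite -(K0 t t01) /K -/(r t) -/(F t); field.
  by rewrite r_neq0 // F_neq0.
- move=> t t01; have [_ d _ _] := geoD t t01; apply: is_derive_eq.
  rewrite -(E0 t t01) /E /F; field.
  by have /andP[h1 h2] := rm t t01; rewrite r_neq0 // gt_eqF //; lra.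
- move=> t t01; rewrite -(E0 t t01) -(K0 t t01).
  have -> : 2 * m / r t - 1 = - F t by rewrite /F; ring.
  rewrite /E /K; field; exact: F_neq0.
- by rewrite /s u0 u1 !mxE /= subr0.
Qed.

End Surface.

Theorem theorem6 (R : realType) (m : R) (hm : 0 < m) :
  geodesically_connected (inner_schwarzschild m) (inner_schwarzschild_atlas m) /\
  ~ geodesically_connected (inner_surface m) (inner_surface_atlas m).
Proof.
split; first exact: inner_schwarzschild_connected.
exact: inner_surface_not_connected.
Qed.
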